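(* Let $M$ be a semisimple Frobenius manifold with charge $d<1$, let $(u^1,\dots,u^n)$ be its canonical coordinates, and let $\lambda(p,u^1,\dots,u^n)$ be its superpotential, with inverse $p(\lambda,u^1,\dots,u^n)$. Then the covariant and contravariant components of the metric $\eta$ in canonical coordinates admit the quadratic expansions $$\eta_{ij}=-\frac{1}{2\pi \sqrt{-1}}\int_C\partial_ip(\lambda,u^1,\dots,u^n)\,\partial_jp(\lambda,u^1,\dots,u^n)\,d\lambda,$$ $$\eta^{ij}=-\frac{1}{2\pi \sqrt{-1}}\int_C W^i(\lambda,u^1,\dots,u^n)\,W^j(\lambda,u^1,\dots,u^n)\,d\lambda,$$ where $C$ is the image in the $\lambda$-plane of the union $\Gamma$ of small closed contours around the critical points $p_1,\dots,p_n$ of $\lambda$, and where the functions $$W^i(\lambda,u^1,\dots,u^n)=\frac{\partial_ip(\lambda,u^1,\dots,u^n)}{\eta_{ii}}$$ are generating functions of symmetries of the semi-Hamiltonian hierarchy associated with $M$.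
   Context: A Frobenius manifold is a manifold $M$ of dimension $n$ with a commutative associative product $\cdot$ on the tangent spaces and a flat metric $\eta$ such that $c(u,v,w)=\eta(u\cdot v,w)$ and $\nabla_zc(u,v,w)$ are totally symmetric ($\nabla$ the Levi-Civita connection of $\eta$), with a unit vector field $e=\partial/\partial v^1$ in flat coordinates $(v^1,\dots,v^n)$ of $\eta$, so that locally $c_{\alpha\beta\gamma}=\partial^3F/\partial v^\alpha\partial v^\beta\partial v^\gamma$ for a potential $F$; and with an Euler vector field $E$, linear in flat coordinates, such that $\mathrm{Lie}_E F=(3-d)F$, where the constant $d$ is the charge. A second flat metric is given by $g^{\alpha\beta}=E^\epsilon c^{\alpha\beta}_\epsilon$ (index raised with $\eta$); its Levi-Civita connection is $\nabla^*$. $M$ is semisimple if the algebra $T_vM$ is semisimple at a generic point; then there are canonical coordinates $(u^1,\dots,u^n)$, the roots of $\det(g^{\alpha\beta}-\lambda\eta^{\alpha\beta})=0$, in which $\partial_i\cdot\partial_j=\delta_{ij}\partial_j$ ($\partial_i=\partial/\partial u^i$), both metrics are diagonal, and $\eta$ is of Egorov type ($\eta_{ii}=\partial_iH$ for some function $H$). Associated hierarchy: the Gauss–Manin system $(\nabla^*-\lambda\nabla)\,dc=0$ (i.e. $g^{\alpha\beta}\nabla^*_\beta dc=\lambda\,\eta^{\alpha\beta}\nabla_\beta dc$) characterizes the flat coordinates $c$ of the pencil $g-\lambda\eta$. The coefficients $c_{\alpha,k}$ of the expansions at $\lambda=\infty$ of a complete set of solutions are the Hamiltonian densities of the hierarchy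 $v^\beta_{t_{\alpha,k}}=\eta^{\beta\gamma}\partial_x\frac{\delta H_{\alpha,k}}{\delta v^\gamma}$, $H_{\alpha,k}=\int c_{\alpha,k}\,dx$. This hierarchy is diagonal in canonical coordinates and semi-Hamiltonian. A symmetry is a diagonal flow $u^i_\tau=w^i(u)u^i_x$ commuting with the hierarchy, i.e. with $\partial_jw^i=\frac{\partial_jv^i}{v^j-v^i}(w^j-w^i)$ for $i\ne j$, where $v^i$ are the characteristic velocities of a flow of the hierarchy with distinct $v^i$ (equivalently $\partial_jw^i=(\partial_j\ln\sqrt{\eta_{ii}})(w^j-w^i)$). That $W^i(\lambda,u)$ is a generating function of symmetries means that, for each $\lambda$ (equivalently, coefficient by coefficient in its expansion in $\lambda$), it gives characteristic velocities of a symmetry. Superpotential: for a semisimple Frobenius manifold with $d<1$ there is a function $\lambda(p,u^1,\dots,u^n)$, the superpotential, with the following properties: its inverse $p(\lambda,u^1,\dots,u^n)$ with respect to $p$ is a (special) solution of the Gauss–Manin system and a generating function of Hamiltonian densities of the hierarchy; its critical values in $p$ are the canonical coordinates, $\lambda_p(p_i)=0$, $\lambda(p_i)=u^i$, $i=1,\dots,n$; and in canonical coordinates $$\eta_{ij}=-\sum_{k=1}^n\operatorname*{Res}_{p=p_k}\frac{\partial_i\lambda\,\partial_j\lambda}{\lambda_p}\,dp=-\frac{1}{2\pi\sqrt{-1}}\int_\Gamma\frac{\partial_i\lambda\,\partial_j\lambda}{\lambda_p}\,dp,$$ with $\Gamma$ the union of small positively oriented closed contours around $p_1,\dots,p_n$.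 $C=\lambda(\Gamma)$ carries the orientation induced from $\Gamma$, and on $C$ the function $p(\lambda,u)$ denotes the branch with values on $\Gamma$. *)

(* Defs.v *)
From HB Require Import structures.
From mathcomp Require Import all_boot all_order all_algebra.
From mathcomp Require Import complex.
From mathcomp Require Import all_classical all_reals all_analysis.
Set Implicit Arguments.
Unset Strict Implicit.
Unset Printing Implicit Defensive.
Import Order.TTheory GRing.Theory Num.Theory.
Import numFieldNormedType.Exports.
Local Open Scope classical_set_scope.
Local Open Scope ring_scope.

(* R[i] under a name typed as a numClosedFieldType, so that the topology and
   the normed module structure of a numeric field are inferred for it. *)
Definition Cplx (R : realType) : numClosedFieldType := R[i]%C.

Section ComplexCalculus.
Variable R : realType.
Local Notation C := (Cplx R).

Definition re (z : C) : R := complex.Re z.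

Definition im (z : C) : R := complex.Im z.

Definition twopii : C := (0 +i* (2 * pi))%C.

Definition itderive (V : normedModType C) (s : seq V) (f : V -> C) : V -> C :=
  foldr (fun v g => 'D_v g) f s.

(* Holomorphy on an open set, in the form: all iterated complex directional
   derivatives exist and are complex differentiable.  (By Cauchy's theory this
   is the same as complex differentiability on the open set.) *)
Definition holo_on (V : normedModType C) (U : set V) (f : V -> C) : Prop :=
  forall (s : seq V) (x : V), U x -> differentiable (itderive s f) x.

Definition pd (m : nat) (i : 'I_m.+1) (f : 'rV[C]_m.+1 -> C) :
    'rV[C]_m.+1 -> C :=
  'D_(delta_mx 0 i) f.

Definition cderiv (c : R -> C) (t : R) : C :=
  (derive1 (re \o c) t +i* derive1 (im \o c) t)%C.

Definition cint01 (f : R -> C) : C :=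
  ((\int[lebesgue_measure]_(t in `[0%R, 1%R]) re (f t)) +i*
   (\int[lebesgue_measure]_(t in `[0%R, 1%R]) im (f t)))%C.

(* A contour is a finite list of arcs parametrized by [0, 1].  A C^1 arc on
   [0, 1] always extends to a C^1 map on the real line, so arcs are total. *)
Record contour := Contour { narc : nat; arc : nat -> R -> C }.

Definition C1_arc (c : R -> C) : Prop :=
  [/\ forall t, derivable (re \o c) t 1,
      forall t, derivable (im \o c) t 1,
      continuous (derive1 (re \o c)) & continuous (derive1 (im \o c))].

Definition closed_contour (G : contour) : Prop :=
  forall s, (s < narc G)%N ->
    C1_arc (arc G s) /\ arc G s 1 = arc G (s.+1 %% narc G)%N 0.

(* The integral, along the image of the contour G under F, of the function
   whose value at the point F (arc G s t) of the image is f s t.  The integrand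
   is indexed by the parameter and not by the point of the image, because the
   image curve may pass several times through the same point on different
   branches of a multivalued integrand. *)
Definition image_int (G : contour) (F : C -> C) (f : nat -> R -> C) : C :=
  \sum_(s < narc G) cint01 (fun t => f s t * cderiv (F \o arc G s) t).

Definition contour_int (G : contour) (f : C -> C) : C :=
  image_int G id (fun s t => f (arc G s t)).

Definition circle (z : C) (r : R) : contour :=
  Contour 1 (fun _ t =>
    z + ((r * cos (2 * pi * t)) +i* (r * sin (2 * pi * t)))%C).

Definition is_residue (f : C -> C) (z c : C) : Prop :=
  \forall r \near 0^'+, contour_int (circle z r) f = twopii * c.

End ComplexCalculus.

Section LocalGeometry.
Variables (R : realType) (n : nat).
Local Notation C := (Cplx R).
Local Notation Cn := 'rV[C]_n.+1.
Local Notation idx := 'I_n.+1.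

(* Components in one coordinate chart; G is a covariant metric. *)
Definition christoffel (G : Cn -> 'M[C]_n.+1) (x : Cn) (k i j : idx) : C :=
  2^-1 * \sum_l invmx (G x) k l *
    (pd i (fun y => G y l j) x + pd j (fun y => G y l i) x
     - pd l (fun y => G y i j) x).

(* nabla_i d_j f *)
Definition hess (G : Cn -> 'M[C]_n.+1) (f : Cn -> C) (x : Cn) : 'M[C]_n.+1 :=
  \matrix_(i, j) (pd i (pd j f) x - \sum_k christoffel G x k i j * pd k f x).

(* R^k_{l i j} *)
Definition riemann (G : Cn -> 'M[C]_n.+1) (x : Cn) (k l i j : idx) : C :=
  pd i (fun y => christoffel G y k j l) x
  - pd j (fun y => christoffel G y k i l) x
  + \sum_m (christoffel G x k i m * christoffel G x m j l
            - christoffel G x k j m * christoffel G x m i l).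

(* nabla_l T_{ijk} *)
Definition nabla3 (G : Cn -> 'M[C]_n.+1) (T : Cn -> idx -> idx -> idx -> C)
    (x : Cn) (l i j k : idx) : C :=
  pd l (fun y => T y i j k) x
  - \sum_m (christoffel G x m l i * T x m j k
            + christoffel G x m l j * T x i m k
            + christoffel G x m l k * T x i j m).

(* P x i j k is the structure constant c^k_{ij}:
   d_i . d_j = sum_k c^k_{ij} d_k. *)
Definition lower3 (G : Cn -> 'M[C]_n.+1) (P : Cn -> idx -> idx -> idx -> C)
    (x : Cn) (i j k : idx) : C := \sum_l P x i j l * G x l k.

Definition intersection_form (G : Cn -> 'M[C]_n.+1)
    (P : Cn -> idx -> idx -> idx -> C) (E : Cn -> idx -> C) (x : Cn) :
    'M[C]_n.+1 :=
  \matrix_(a, b) \sum_e E x e * \sum_m invmx (G x) a m * P x m e b.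

(* [L_E P]^k_{ij} *)
Definition lie3 (E : Cn -> idx -> C) (P : Cn -> idx -> idx -> idx -> C)
    (x : Cn) (i j k : idx) : C :=
  \sum_l (E x l * pd l (fun y => P y i j k) x
          - P x i j l * pd l (fun y => E y k) x
          + P x l j k * pd i (fun y => E y l) x
          + P x i l k * pd j (fun y => E y l) x).

Definition semisimple_algebra (c : idx -> idx -> idx -> C) : Prop :=
  exists2 f : 'M[C]_n.+1, f \in unitmx &
    forall a b k, \sum_i \sum_j f a i * f b j * c i j k
                  = if a == b then f a k else 0.

End LocalGeometry.

(* A complex Frobenius manifold of dimension n.+1: a complex manifold given by
   a holomorphic atlas (not assumed maximal), with tensor fields given by
   their components in the charts.  The index 0 stands for the first
   coordinate.  The metric eta is a complex-valued symmetric bilinear form. *)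
Record frobenius_manifold (R : realType) (n : nat) := FrobeniusManifold {
  carrier : topologicalType;
  carrier_hausdorff : hausdorff_space carrier;
  carrier_countable : @second_countable carrier;

  chart : Type;
  chart_dom : chart -> set carrier;
  chart_coord : chart -> carrier -> 'rV[Cplx R]_n.+1;
  point_of : chart -> 'rV[Cplx R]_n.+1 -> carrier;
  chart_img := fun a : chart => chart_coord a @` chart_dom a;
  dom_open : forall a, open (chart_dom a);
  dom_cover : forall q, exists a, chart_dom a q;
  img_open : forall a, open (chart_img a);
  coordK : forall a q, chart_dom a q -> point_of a (chart_coord a q) = q;
  coord_continuous : forall a q, chart_dom a q ->
    {for q, continuous (chart_coord a)};
  point_of_continuous : forall a x, chart_img a x ->
    {for x, continuous (point_of a)};
  transition := fun (a b : chart) (x : 'rV[Cplx R]_n.+1) =>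
    chart_coord b (point_of a x);
  trans_holo : forall a b j,
    holo_on (chart_coord a @` (chart_dom a `&` chart_dom b))
            (fun x => transition a b x 0 j);
  jac := fun (a b : chart) (x : 'rV[Cplx R]_n.+1) (j i : 'I_n.+1) =>
    pd i (fun y => transition a b y 0 j) x;

  fm_eta : chart -> 'rV[Cplx R]_n.+1 -> 'M[Cplx R]_n.+1;
  fm_mult : chart -> 'rV[Cplx R]_n.+1 ->
    'I_n.+1 -> 'I_n.+1 -> 'I_n.+1 -> Cplx R;
  fm_unit : chart -> 'rV[Cplx R]_n.+1 -> 'I_n.+1 -> Cplx R;
  fm_euler : chart -> 'rV[Cplx R]_n.+1 -> 'I_n.+1 -> Cplx R;
  fm_charge : Cplx R;

  eta_holo : forall a i j, holo_on (chart_img a) (fun x => fm_eta a x i j);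
  mult_holo : forall a i j k,
    holo_on (chart_img a) (fun x => fm_mult a x i j k);
  unitf_holo : forall a i, holo_on (chart_img a) (fun x => fm_unit a x i);
  euler_holo : forall a i, holo_on (chart_img a) (fun x => fm_euler a x i);

  eta_tensor : forall a b q, chart_dom a q -> chart_dom b q -> forall i j,
    fm_eta a (chart_coord a q) i j =
    \sum_k \sum_l jac a b (chart_coord a q) k i * jac a b (chart_coord a q) l j
                  * fm_eta b (chart_coord b q) k l;
  mult_tensor : forall a b q, chart_dom a q -> chart_dom b q -> forall i j m,
    \sum_k jac a b (chart_coord a q) m k * fm_mult a (chart_coord a q) i j k =
    \sum_k \sum_l jac a b (chart_coord a q) k i * jac a b (chart_coord a q) l j
                  * fm_mult b (chart_coord b q) k l m;
  unitf_tensor : forall a b q, chart_dom a q -> chart_dom b q -> forall j,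
    fm_unit b (chart_coord b q) j =
    \sum_i jac a b (chart_coord a q) j i * fm_unit a (chart_coord a q) i;
  euler_tensor : forall a b q, chart_dom a q -> chart_dom b q -> forall j,
    fm_euler b (chart_coord b q) j =
    \sum_i jac a b (chart_coord a q) j i * fm_euler a (chart_coord a q) i;

  multC : forall a x, chart_img a x -> forall i j k,
    fm_mult a x i j k = fm_mult a x j i k;
  multA : forall a x, chart_img a x -> forall i j l m,
    \sum_k fm_mult a x i j k * fm_mult a x k l m =
    \sum_k fm_mult a x j l k * fm_mult a x i k m;
  mult1 : forall a x, chart_img a x -> forall j k,
    \sum_i fm_unit a x i * fm_mult a x i j k = (j == k)%:R;
  eta_sym : forall a x, chart_img a x -> (fm_eta a x)^T = fm_eta a x;
  eta_unit : forall a x, chart_img a x -> fm_eta a x \in unitmx;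
  c_sym : forall a x, chart_img a x -> forall i j k,
    lower3 (fm_eta a) (fm_mult a) x i j k =
      lower3 (fm_eta a) (fm_mult a) x j i k /\
    lower3 (fm_eta a) (fm_mult a) x i j k =
      lower3 (fm_eta a) (fm_mult a) x i k j;
  nabla_c_sym : forall a x, chart_img a x -> forall l i j k,
    [/\ nabla3 (fm_eta a) (lower3 (fm_eta a) (fm_mult a)) x l i j k =
        nabla3 (fm_eta a) (lower3 (fm_eta a) (fm_mult a)) x i l j k,
        nabla3 (fm_eta a) (lower3 (fm_eta a) (fm_mult a)) x l i j k =
        nabla3 (fm_eta a) (lower3 (fm_eta a) (fm_mult a)) x l j i k &
        nabla3 (fm_eta a) (lower3 (fm_eta a) (fm_mult a)) x l i j k =
        nabla3 (fm_eta a) (lower3 (fm_eta a) (fm_mult a)) x l i k j];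
  eta_flat : forall a x, chart_img a x -> forall k l i j,
    riemann (fm_eta a) x k l i j = 0;

  (* L_E(.) = . fixes the normalization [e, E] = e of the Euler field, without
     which the charge is not determined by L_E F = (3 - d) F. *)
  euler_mult : forall a x, chart_img a x -> forall i j k,
    lie3 (fm_euler a) (fm_mult a) x i j k = fm_mult a x i j k;

  (* Flat coordinates, potential, and Euler field around every point; "linear"
     is read as affine, as is usual for the Euler field. *)
  flat_coordinates : forall q, exists2 a, chart_dom a q &
    [/\ forall x y, chart_img a x -> chart_img a y -> fm_eta a x = fm_eta a y,
        forall x, chart_img a x -> forall i, fm_unit a x i = (i == 0)%:R,
        exists (Q : 'M[Cplx R]_n.+1) (r : 'rV[Cplx R]_n.+1),
          forall x, chart_img a x -> forall i,
            fm_euler a x i = (x *m Q + r) 0 i &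
        exists F : 'rV[Cplx R]_n.+1 -> Cplx R,
          [/\ holo_on (chart_img a) F,
              forall x, chart_img a x -> forall i j k,
                lower3 (fm_eta a) (fm_mult a) x i j k = pd i (pd j (pd k F)) x &
              forall x, chart_img a x ->
                \sum_i fm_euler a x i * pd i F x = (3 - fm_charge) * F x]]
}.

Arguments chart_img {R n f}.
Arguments chart_dom {R n f}.
Arguments chart_coord {R n f}.
Arguments fm_eta {R n f}.
Arguments fm_mult {R n f}.
Arguments fm_euler {R n f}.
Arguments fm_charge {R n}.

Section Hierarchy.
Variables (R : realType) (n : nat) (M : frobenius_manifold R n).
Local Notation C := (Cplx R).
Local Notation Cn := 'rV[C]_n.+1.
Local Notation idx := 'I_n.+1.

(* Semisimplicity of the tangent algebra at a generic point, i.e. on a dense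
   set (this set is automatically open). *)
Definition semisimple : Prop :=
  closure [set q : carrier M |
    exists2 a : chart M, chart_dom a q &
      semisimple_algebra (fm_mult a (chart_coord a q))]
  = setT.

Section Chart.
Variable a : chart M.

Definition etaup (x : Cn) : 'M[C]_n.+1 := invmx (fm_eta a x).

Definition gup (x : Cn) : 'M[C]_n.+1 :=
  intersection_form (fm_eta a) (fm_mult a) (fm_euler a) x.

Definition glow (x : Cn) : 'M[C]_n.+1 := invmx (gup x).

(* d_i . d_j = delta_ij d_j, and the coordinates are the roots, with
   multiplicity, of det (g - l eta) (contravariant components). *)
Definition canonical_chart : Prop :=
  (forall x, chart_img a x -> forall i j k,
     fm_mult a x i j k = ((i == j) && (j == k))%:R) /\
  (forall x, chart_img a x -> exists2 kappa : C, kappa != 0 &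
     forall l : C, \det (gup x - l *: etaup x) = kappa * \prod_i (x 0 i - l)).

(* g^{ab} nabla*_b d f = l eta^{ab} nabla_b d f at the point x.  The connection
   nabla* exists only off the discriminant det g = 0. *)
Definition gauss_manin (l : C) (f : Cn -> C) (x : Cn) : Prop :=
  gup x \in unitmx ->
  gup x *m hess glow f x = l *: (etaup x *m hess (fm_eta a) f x).

(* sum_k c_k l^(rho - k) is a formal solution of the Gauss-Manin system, whose
   operators do not involve d/dl, so that rho plays no role. *)
Definition gauss_manin_series (c : nat -> Cn -> C) (x : Cn) : Prop :=
  etaup x *m hess (fm_eta a) (c 0%N) x = 0 /\
  (gup x \in unitmx -> forall k,
    gup x *m hess glow (c k) x = etaup x *m hess (fm_eta a) (c k.+1) x).

(* Hamiltonian densities of the hierarchy: coefficients of the expansions at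
   l = oo of a complete set of solutions
     c_alpha = l^rho_alpha sum_(m < nlog) sum_k dens alpha m k (log l)^m l^(-k)
   (nlog = 1 when there is no resonance).  Each power of log l solves the
   system separately.  Completeness: the Jacobian of (c_alpha), which is a
   formal series in l^-1 with coefficients polynomial in log l, is nonzero. *)
Record hierarchy (D : set Cn) := Hierarchy {
  nlog : nat;
  dens : idx -> nat -> nat -> Cn -> C;
  dens_holo : forall al m k, (m < nlog)%N -> holo_on D (dens al m k);
  dens_gm : forall al m x, (m < nlog)%N -> D x ->
    gauss_manin_series (dens al m) x;
  dens_complete : forall x, D x -> exists k : nat,
    (\det (\matrix_(al < n.+1, i < n.+1)
       \poly_(j < k.+1) (\poly_(m < nlog) pd i (dens al m j) x)))`_k
      != 0 :> {poly C}
}.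

(* The flow v^b_t = eta^{bc} d_x (dh/dv^c) (v flat coordinates, H = int h dx),
   written in the coordinates u of the chart:
     u^i_t = (nabla^i nabla_j h) u^j_x. *)
Definition ham_flow (h : Cn -> C) (u : Cn) : 'M[C]_n.+1 :=
  etaup u *m hess (fm_eta a) h u.

Definition hierarchy_flow D (H : hierarchy D) (V : Cn -> 'M[C]_n.+1) : Prop :=
  exists al m k, (m < nlog H)%N /\ V = ham_flow (dens H al m k).

(* derivative of V at u along the vector b *)
Definition dirder (V : Cn -> 'M[C]_n.+1) (u : Cn) (b : 'cV[C]_n.+1) :
    'M[C]_n.+1 :=
  \matrix_(i, j) \sum_k b k 0 * pd k (fun y => V y i j) u.

(* u_t = V(u) u_x and u_s = W(u) u_x commute: with b = u_x and b' = u_xx, the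
   two sides are (u_s)_t and (u_t)_s. *)
Definition commute_at (V W : Cn -> 'M[C]_n.+1) (u : Cn) : Prop :=
  forall b b' : 'cV[C]_n.+1,
    dirder W u (V u *m b) *m b + W u *m (dirder V u b *m b + V u *m b') =
    dirder V u (W u *m b) *m b + V u *m (dirder W u b *m b + W u *m b').

(* On the set D', u^i_s = w^i(u) u^i_x commutes with the hierarchy; then the
   two equivalent forms of the linear system for w.  Note that
   d_j (ln sqrt eta_ii) = d_j eta_ii / (2 eta_ii). *)
Definition is_symmetry D (H : hierarchy D) (D' : set Cn) (w : idx -> Cn -> C) :
    Prop :=
  [/\ forall V u, hierarchy_flow H V -> D' u ->
        commute_at V (fun y => diag_mx (\row_i w i y)) u,
      forall V u, hierarchy_flow H V -> D' u ->
        injective (fun i => V u i i) ->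
        forall i j, i != j ->
          pd j (w i) u = pd j (fun y => V y i i) u / (V u j j - V u i i)
                         * (w j u - w i u) &
      forall u, D' u -> forall i j, i != j ->
        pd j (w i) u = pd j (fun y => fm_eta a y i i) u / (2 * fm_eta a u i i)
                       * (w j u - w i u)].

(* A holomorphic branch p(l, u), on the open set B, of the inverse in the first
   variable of a function lam with domain Om. *)
Definition inverse_branch (Om : set (C * Cn)) (lam : C * Cn -> C)
    (B : set (C * Cn)) (p : C * Cn -> C) : Prop :=
  [/\ open B, holo_on B p &
      forall l u, B (l, u) -> Om (p (l, u), u) /\ lam (p (l, u), u) = l].

Definition dp (lam : C * Cn -> C) : C * Cn -> C := 'D_((1, 0) : C * Cn) lam.

Definition du (i : idx) (lam : C * Cn -> C) : C * Cn -> C :=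
  'D_((0, delta_mx 0 i) : C * Cn) lam.

(* A closed contour winding once positively around z, inside a disc contained
   in the domain and in which z is the only possible critical point. *)
Definition small_contour (Om : set (C * Cn)) (lam : C * Cn -> C) (u : Cn)
    (z : C) (G : contour R) : Prop :=
  [/\ closed_contour G,
      contour_int G (fun p => (p - z)^-1) = twopii R &
      exists2 r : R, 0 < r &
        (forall p : C, `|p - z| < r%:C%C ->
           Om (p, u) /\ (p != z -> dp lam (p, u) != 0)) /\
        (forall s t, (s < narc G)%N -> 0 <= t <= 1 ->
           0 < `|arc G s t - z| < r%:C%C)].

(* Any two branches of the inverse are meant to be analytic continuations of
   each other, so all of them solve the Gauss-Manin system. *)
Record superpotential := Superpotential {
  sp_dom : set (C * Cn);
  lam : C * Cn -> C;
  crit : idx -> Cn -> C;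
  sp_open : open sp_dom;
  sp_sub : forall p u, sp_dom (p, u) -> chart_img a u;
  sp_holo : holo_on sp_dom lam;
  sp_gm : forall B p, inverse_branch sp_dom lam B p ->
    forall l u, B (l, u) -> gauss_manin l (fun y => p (l, y)) u;
  crit_dom : forall i u, chart_img a u -> sp_dom (crit i u, u);
  crit_point : forall i u, chart_img a u -> dp lam (crit i u, u) = 0;
  crit_value : forall i u, chart_img a u -> lam (crit i u, u) = u 0 i;
  crit_values : forall p u, sp_dom (p, u) -> dp lam (p, u) = 0 ->
    exists i, lam (p, u) = u 0 i;
  sp_residue : forall u, chart_img a u -> forall i j, exists2 rho : idx -> C,
    forall k, is_residue
      (fun p => du i lam (p, u) * du j lam (p, u) / dp lam (p, u))
      (crit k u) (rho k) &
    fm_eta a u i j = - \sum_k rho k;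
  sp_contour : forall u, chart_img a u -> forall Gam : idx -> contour R,
    (forall k, small_contour sp_dom lam u (crit k u) (Gam k)) -> forall i j,
    fm_eta a u i j = - (twopii R)^-1 * \sum_k contour_int (Gam k)
      (fun p => du i lam (p, u) * du j lam (p, u) / dp lam (p, u))
}.

(* Along the union of the contours Gam k, P k s t is a branch of the inverse of
   lam, near the image of the point arc (Gam k) s t and taking there this point
   as its value. *)
Definition branches_on (S : superpotential) (u : Cn) (Gam : idx -> contour R)
    (P : idx -> nat -> R -> C * Cn -> C) : Prop :=
  forall k s t, (s < narc (Gam k))%N -> 0 <= t <= 1 ->
    exists2 B, inverse_branch (sp_dom S) (lam S) B (P k s t) &
      B (lam S (arc (Gam k) s t, u), u) /\
      P k s t (lam S (arc (Gam k) s t, u), u) = arc (Gam k) s t.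

(* Integral over C = lam (Gam), with its induced orientation, of an expression
   f p l in the branch p of the inverse and the point l of C. *)
Definition int_over_C (S : superpotential) (u : Cn) (Gam : idx -> contour R)
    (P : idx -> nat -> R -> C * Cn -> C) (f : (C * Cn -> C) -> C -> C) : C :=
  \sum_k image_int (Gam k) (fun p => lam S (p, u))
           (fun s t => f (P k s t) (lam S (arc (Gam k) s t, u))).

Definition dpinv (i : idx) (p : C * Cn -> C) (l : C) (u : Cn) : C :=
  pd i (fun y => p (l, y)) u.

Definition Wfun (i : idx) (p : C * Cn -> C) (l : C) (u : Cn) : C :=
  dpinv i p l u / fm_eta a u i i.

End Chart.
End Hierarchy.

(* Main.v *)
(** The first expansion is the change of variable [l = lam p] in the residue
    formula for [eta]: implicit differentiation of [lam (p (l, u), u) = l] gives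
    [d_i p = - d_i lam / lam_p], and [dl = lam_p dp].  The second one follows
    because [eta] is diagonal in canonical coordinates.

    For the symmetries, write [G_ij = d_j ln (sqrt eta_ii)].  The metrics [eta]
    and [g] are both diagonal, with quotient [E^i], and [d_j E^i = delta_ij], so
    that the off-diagonal part of the Gauss-Manin system reads
    [(E^i - l) (d_i d_j f - G_ij d_i f - G_ji d_j f) = 0] outside the
    discriminant.  Points where [E^i <> l] and [g] is nondegenerate are dense, so
    [p] solves [d_i d_j f = G_ij d_i f + G_ji d_j f] everywhere; as [eta] is
    Egorov, [w_i = d_i p / eta_ii] then solves [d_j w_i = G_ij (w_j - w_i)].
    The same argument, by induction on the order in [1 / l], makes the flows of
    the hierarchy diagonal, and flatness of [eta] (the Codazzi equations for the
    Hessian of the Hamiltonian density) shows that their velocities solve that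
    same linear system.  Diagonal flows whose velocities solve the same such
    system commute. *)

Require Import Defs.
From HB Require Import structures.
From mathcomp Require Import all_boot all_order all_algebra.
From mathcomp Require Import complex ring.
From mathcomp Require Import all_classical all_reals all_analysis.
Set Implicit Arguments.
Unset Strict Implicit.
Unset Printing Implicit Defensive.
Import Order.TTheory GRing.Theory Num.Theory.
Import numFieldNormedType.Exports.
Local Open Scope classical_set_scope.
Local Open Scope ring_scope.

(** * Complex-valued curves *)

Section ComplexLimits.
Variable R : realType.
Local Notation C := (Cplx R).
Implicit Types (z w : C) (r : R).

Lemma reD z w : re (z + w) = re z + re w. Proof. by case: z w => [? ?] [? ?]. Qed.
Lemma imD z w : im (z + w) = im z + im w. Proof. by case: z w => [? ?] [? ?]. Qed.
Lemma reB z w : re (z - w) = re z - re w. Proof. by case: z w => [? ?] [? ?]. Qed.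
Lemma imB z w : im (z - w) = im z - im w. Proof. by case: z w => [? ?] [? ?]. Qed.
Lemma reM z w : re (z * w) = re z * re w - im z * im w.
Proof. by case: z w => [? ?] [? ?]. Qed.
Lemma imM z w : im (z * w) = re z * im w + im z * re w.
Proof. by case: z w => [? ?] [? ?]. Qed.

Lemma re_im_inj z w : re z = re w -> im z = im w -> z = w.
Proof. by case: z w => [? ?] [? ?] /= -> ->. Qed.

Lemma ltr_normc_re z (e : R) : `|z| < (e%:C)%C -> `|re z| < e.
Proof. by move=> h; rewrite -ltcR; apply: le_lt_trans h; exact: normc_ge_Re. Qed.

Lemma normc_ge_im z : ((`|im z|)%:C)%C <= `|z|.
Proof. by rewrite (normc_def z) lecR -sqrtr_sqr ler_wsqrtr// lerDr sqr_ge0. Qed.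

Lemma ltr_normc_im z (e : R) : `|z| < (e%:C)%C -> `|im z| < e.
Proof. by move=> h; rewrite -ltcR; apply: le_lt_trans h; exact: normc_ge_im. Qed.

Lemma normc_real (r : R) : `|(r%:C)%C : C| = (`|r|%:C)%C.
Proof. by rewrite normc_def /= expr0n addr0 sqrtr_sqr. Qed.

Lemma ger0_complex z : 0 <= z -> z = ((re z)%:C)%C.
Proof. by case: z => a b; rewrite (lecE (0 : R[i]%C)) => /andP[/eqP /= ->]. Qed.

Lemma re_ge0 z : 0 <= z -> 0 <= re z.
Proof. by case: z => a b; rewrite (lecE (0 : R[i]%C)) => /andP[]. Qed.

Lemma re_continuous : continuous (@re R : C -> R).
Proof.
move=> z; apply/(@cvgrPdist_lt _ _ _ (nbhs z)) => e e0.
have e0' : 0 < (e%:C)%C :> C by rewrite ltcR.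
have /cvgrPdist_lt/(_ _ e0') h : id @ nbhs z --> z by exact: cvg_id.
near=> y; rewrite -reB; apply: ltr_normc_re.
by near: y; exact: h.
Unshelve. all: by end_near. Qed.

Lemma im_continuous : continuous (@im R : C -> R).
Proof.
move=> z; apply/(@cvgrPdist_lt _ _ _ (nbhs z)) => e e0.
have e0' : 0 < (e%:C)%C :> C by rewrite ltcR.
have /cvgrPdist_lt/(_ _ e0') h : id @ nbhs z --> z by exact: cvg_id.
near=> y; rewrite -imB; apply: ltr_normc_im.
by near: y; exact: h.
Unshelve. all: by end_near. Qed.

Lemma real_complex_continuous : continuous ((fun r => (r%:C)%C) : R -> C).
Proof.
move=> r; apply/(@cvgrPdist_lt _ _ _ (nbhs r)) => e e0.
have er := ger0_complex (ltW e0).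
have re0 : 0 < re e by rewrite -ltcR -er.
have /cvgrPdist_lt/(_ _ re0) h : id @ nbhs r --> r by exact: cvg_id.
near=> y; rewrite er -(raddfB (real_complex R)) normc_real ltcR.
by near: y; exact: h.
Unshelve. all: by end_near. Qed.

Lemma cvg_complexP (T : Type) (F : set_system T) (FF : Filter F) (f : T -> C) z :
  f @ F --> z <-> (@re R \o f) @ F --> re z /\ (@im R \o f) @ F --> im z.
Proof.
split=> [h|[h1 h2]].
  split; first exact: (@continuous_cvg _ _ _ F FF f (@re R) z (@re_continuous z) h).
  exact: (@continuous_cvg _ _ _ F FF f (@im R) z (@im_continuous z) h).
have E w : w = ((re w)%:C)%C + ((im w)%:C)%C * ('i)%C.
  by apply: re_im_inj; rewrite ?reD ?imD ?reM ?imM /= ?(mulr0,mulr1,mul0r,addr0,subr0,add0r).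
have -> : f = (fun t => ((re (f t))%:C)%C + ((im (f t))%:C)%C * ('i)%C).
  by apply: boolp.funext => t; exact: E.

have H1 := @continuous_cvg _ _ _ F FF _ _ _ (@real_complex_continuous (re z)) h1.
have H2 := @continuous_cvg _ _ _ F FF _ _ _ (@real_complex_continuous (im z)) h2.
have H3 := @cvgMr_tmp C _ _ FF _ _ ('i)%C H2.
have := @cvgD C C _ _ FF _ _ _ _ H1 H3.
by rewrite -E.
Qed.

End ComplexLimits.

(** * Differentiation of complex-valued functions of a real variable *)

Section Curves.
Variable R : realType.
Local Notation C := (Cplx R).
Implicit Types (c : R -> C) (t : R) (z d : C).

(** The real increment is embedded in [C] before the product is taken, so that limits along [R]
    combine with the field operations of [C]. *)
Definition curve_derive c t d :=
  (fun h : R => ((h^-1)%:C)%C * (c (h + t) - c t)) @ 0^' --> d.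

Lemma curve_deriveP c t d : curve_derive c t d <->
  is_derive t 1 (@re R \o c) (re d) /\ is_derive t 1 (@im R \o c) (im d).
Proof.
have quotE (g : R -> R) : (fun h : R => h^-1 *: ((g \o shift t) (h *: 1) - g t))
    = (fun h => h^-1 * (g (h + t) - g t)).
  by apply: boolp.funext => h; rewrite /shift /= /GRing.scale /= mulr1.
have qE : (fun h : R => h^-1 * ((@re R \o c) (h + t) - (@re R \o c) t)) =
   @re R \o (fun h : R => ((h^-1)%:C)%C * (c (h + t) - c t)).
  by apply: boolp.funext => h /=; rewrite reM /= mul0r subr0 reB.
have qE' : (fun h : R => h^-1 * ((@im R \o c) (h + t) - (@im R \o c) t)) =
   @im R \o (fun h : R => ((h^-1)%:C)%C * (c (h + t) - c t)).
  by apply: boolp.funext => h /=; rewrite imM /= mul0r addr0 imB.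
split.
  move=> /cvg_complexP[]; rewrite -qE -qE' -!quotE => h1 h2.
  split; split; [by apply/cvg_ex; eexists; exact: h1| exact: cvg_lim h1
               |by apply/cvg_ex; eexists; exact: h2| exact: cvg_lim h2].
move=> [[h1 e1] [h2 e2]]; apply/cvg_complexP; rewrite -qE -qE' -!quotE.
by rewrite -e1 -e2; split; [exact: h1|exact: h2].
Qed.

Lemma curve_derive_cderiv c t d : curve_derive c t d -> cderiv c t = d.
Proof.
move=> /curve_deriveP[[_ h1] [_ h2]].
by rewrite /cderiv !derive1E h1 h2; case: d {h1 h2}.
Qed.

Lemma cderivP c t : derivable (@re R \o c) t 1 -> derivable (@im R \o c) t 1 ->
  curve_derive c t (cderiv c t).
Proof.
move=> h1 h2; apply/curve_deriveP; rewrite /cderiv /= !derive1E.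
by split; exact: derivableP.
Qed.

Lemma curve_derive_cvg c t d : curve_derive c t d ->
  c (h + t) - c t @[h --> 0^'] --> (0 : C).
Proof.
move=> hc.
have h0 : ((h%:C)%C : C) @[h --> 0^'] --> (0 : C).
  have /continuous_withinNx := @real_complex_continuous R 0.
  exact.
have := @cvgM C _ _ (dnbhs_filter (0 : R)) _ _ _ _ h0 hc; rewrite mul0r.
move=> H; apply: cvg_trans H; apply: near_eq_cvg; near=> h.
rewrite /= mulrA -rmorphM /= mulfV ?rmorph1 ?mul1r//.
by near: h; exact: nbhs_dnbhs_neq.
Unshelve. all: by end_near. Qed.

(** The chain rule for a complex differentiable function along a real curve, by Caratheodory's
    device: the difference quotient of [F], completed by its derivative, is continuous at 0. *)
Lemma curve_derive_comp (F : C -> C) c t d :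
  differentiable F (c t) -> curve_derive c t d ->
  curve_derive (F \o c) t ('D_1 F (c t) * d).
Proof.
move=> dF hc; set D := 'D_1 F (c t).
(* The value at 0 covers the increments [h] with [c (h + t) = c t], for which the difference
   quotient of [F] would divide by zero. *)
pose G (k : C) : C := if k == 0 then D else k^-1 * (F (k + c t) - F (c t)).
have G0 : {for 0, continuous G}.
  apply/(@continuous_withinNx C C).
  have hD : (fun k : C => k^-1 *: ((F \o shift (c t)) (k *: 1) - F (c t))) @ 0^' --> D.
    exact: (diff_derivable dF).
  rewrite {2}/G eqxx.
  apply: cvg_trans hD; apply: near_eq_cvg; near=> k.
  rewrite /G ifF /shift /=; first by rewrite /GRing.scale /= mulr1.
  by apply/negbTE; near: k; exact: nbhs_dnbhs_neq.
have h1 := @continuous_cvg _ _ _ _ (dnbhs_filter (0 : R)) _ G _ G0 (curve_derive_cvg hc).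
have := @cvgM C _ _ (dnbhs_filter (0 : R)) _ _ _ _ h1 hc; rewrite {2}/G eqxx.
move=> H; apply: cvg_trans H; apply: near_eq_cvg; near=> h => /=.
rewrite /G; case: eqP => [/subr0_eq ->|/eqP k0]; first by rewrite !subrr !mulr0.
rewrite subrK mulrCA; congr (_ * _); rewrite mulrAC mulVf ?mul1r//.
Unshelve. all: by end_near. Qed.

End Curves.

(** * Symmetry of mixed derivatives *)

(** Transfers directional derivatives between different spaces, as from a function to its
    restriction to a line or a slice. *)
Lemma eq_derive (K : numFieldType) (U V W : normedModType K)
  (f : U -> W) (g : V -> W) a b v w :
  (forall h : K, f (h *: v + a) = g (h *: w + b)) -> 'D_v f a = 'D_w g b.
Proof.
move=> fg; rewrite /derive; set q1 := (fun h => _); set q2 := (fun h => _).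
suff -> : q1 = q2 by [].
have := fg 0; rewrite !scale0r !add0r => fg0.
by rewrite boolp.funeqE => h; rewrite /q1 /q2 /= fg fg0.
Qed.

Section MixedDerivatives.
Variables (R : realType) (V : normedModType (Cplx R)).
Local Notation C := (Cplx R).
Implicit Types (f g : V -> C) (u v w x : V).

Lemma curve_derive_real (t : R) : curve_derive (fun s : R => (s%:C)%C : C) t 1.
Proof.
have H : (1 : C) @[h --> (0 : R)^'] --> (1 : C) by exact: cvg_cst.
rewrite /curve_derive; apply: cvg_trans H; apply: near_eq_cvg; near=> h.
rewrite /= -rmorphB addrK -rmorphM /= mulVf//.
by near: h; exact: nbhs_dnbhs_neq.
Unshelve. all: by end_near. Qed.

(** The real line in the direction [v] is the real axis followed by the complex line [z *: v + x],
    so the chain rule for curves applies. *)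
Lemma curve_derive_line f v x (t : R) : differentiable f ((t%:C)%C *: v + x) ->
  curve_derive (fun s : R => f ((s%:C)%C *: v + x)) t ('D_v f ((t%:C)%C *: v + x)).
Proof.
move=> df; pose F (z : C) : C := f (z *: v + x).
have -> : 'D_v f ((t%:C)%C *: v + x) = 'D_1 F (t%:C)%C * 1.
  rewrite mulr1; apply: eq_derive => h.
  rewrite /F (_ : h *: (1 : C) = h); last exact: mulr1.
  by rewrite scalerDl -addrA.
have dl : differentiable (fun z : C => z *: v + x) ((t%:C)%C : C).
  apply: differentiableD; last exact: differentiable_cst.
  exact: differentiableZl.
apply: (@curve_derive_comp R F (fun s : R => (s%:C)%C) t 1).
  exact: (@differentiable_comp _ _ _ _ (fun z : C => z *: v + x) f).
exact: curve_derive_real.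
Qed.

Lemma differentiable_estimate g x : differentiable g x -> forall e : C, 0 < e ->
  \forall k \near (0 : V), `|g (k + x) - g x - 'd g x k| <= e * `|k|.
Proof.
move=> dg e e0; have H := diff_locallyx dg; near=> k; rewrite H.
have E (a b c : C) : a + b + c - a - b = c.
  by rewrite (addrAC _ c) (addrAC a) subrr add0r addrAC subrr add0r.
rewrite E; near: k; exact: littleoP.
Unshelve. all: by end_near. Qed.

Lemma norm_combination_le v w (s r h : R) : 0 <= s <= h -> 0 <= r <= h ->
  `|(s%:C)%C *: v + (r%:C)%C *: w| <= ((h * (re `|v| + re `|w|))%:C)%C.
Proof.
move=> /andP[s0 sh] /andP[r0 rh].
apply: le_trans (ler_normD _ _) _; rewrite !normrZ !normc_real !ger0_norm//.
rewrite (ger0_complex (normr_ge0 v)) (ger0_complex (normr_ge0 w)) /=.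
rewrite -!rmorphM -rmorphD lecR mulrDr.
have a0 : 0 <= re `|v| by exact: re_ge0 (normr_ge0 _).
have b0 : 0 <= re `|w| by exact: re_ge0 (normr_ge0 _).
by apply: lerD; apply: ler_wpM2r.
Qed.

(** [L] stands for the real or the imaginary part, since the mean value theorem needs real values.
    Applied to [phi], the increment of [f] along [h w] as a function of the step [s] along [v], it
    reduces the second difference to [h] times an increment of ['D_v f], which is estimated by the
    differentiability of ['D_v f] at [x]. *)
Lemma second_difference (L : C -> R) f v w x :
  (forall y z, L (y - z) = L y - L z) ->
  (forall (r : R) z, L ((r%:C)%C * z) = r * L z) ->
  (forall z (e : R), `|z| <= (e%:C)%C -> `|L z| <= e) ->
  (forall c (t : R) d, curve_derive c t d -> is_derive t 1 (L \o c) (L d)) ->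
  (\forall y \near x, differentiable f y) -> differentiable ('D_v f) x ->
  forall e : R, 0 < e -> exists2 d, 0 < d & forall h : R, 0 < h < d ->
  `|L (f ((h%:C)%C *: v + ((h%:C)%C *: w + x))) - L (f ((h%:C)%C *: v + x))
    - L (f ((h%:C)%C *: w + x)) + L (f x) - h ^+ 2 * L ('D_w ('D_v f) x)| <= e * h ^+ 2.
Proof.
move=> LB LZ Ln Ld df dg e e0; set g := 'D_v f.
(* Increments [s v + r w] with [s] and [r] in [[0, h]] have norm less than [h * N]; the summand 1
   makes this strict even when [v] and [w] vanish. *)
pose N := (re `|v| + re `|v| + re `|w|) + 1.
have a0 : 0 <= re `|v| by exact: re_ge0 (normr_ge0 _).
have b0 : 0 <= re `|w| by exact: re_ge0 (normr_ge0 _).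
have N0 : 0 < N by rewrite /N ltr_wpDl// addr_ge0// addr_ge0.
(* On increments of norm at most [h * N] this bounds each of the two remainders by [e / 2 * h]. *)
have e1 : 0 < ((e / 2 / N)%:C)%C :> C by rewrite ltcR !divr_gt0.
have LD a b : L (a + b) = L a + L b by rewrite -[a in RHS](addrK b) LB subrK.
have /nbhs_norm0P[d1 /= d10 D1] := differentiable_estimate dg e1.
have /nbhs_normP[d2 /= d20 D2] := df.
have E1 := ger0_complex (ltW d10); have E2 := ger0_complex (ltW d20).
have r1 : 0 < re d1 by rewrite -ltcR -E1.
have r2 : 0 < re d2 by rewrite -ltcR -E2.
exists (Num.min (re d1) (re d2) / N); first by rewrite divr_gt0// lt_min r1.
move=> h /andP[h0 hd]; set H := (h%:C)%C; move: hd; rewrite ltr_pdivlMr// lt_min => /andP[hd1 hd2].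
have sq (s r : R) : 0 <= s <= h -> 0 <= r <= h ->
    `|(s%:C)%C *: v + (r%:C)%C *: w| < ((h * N)%:C)%C.
  move=> sh rh; apply: le_lt_trans (norm_combination_le v w sh rh) _.
  by rewrite ltcR ltr_pM2l// /N -!addrA ltr_wpDl// ltrD2l ltrDl.
have dfk (s r : R) : 0 <= s <= h -> 0 <= r <= h ->
    differentiable f ((s%:C)%C *: v + ((r%:C)%C *: w + x)).
  move=> sh rh; apply: D2 => /=; rewrite addrA opprD addrCA subrr addr0 normrN.
  by apply: lt_trans (sq _ _ sh rh) _; rewrite E2 ltcR.
have h00 : 0 <= (0 : R) <= h by rewrite lexx ltW.
have hhh : 0 <= h <= h by rewrite lexx ltW.
pose phi := fun s : R => L (f ((s%:C)%C *: v + (H *: w + x))) - L (f ((s%:C)%C *: v + x)).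
pose dphi := fun s : R => L (g ((s%:C)%C *: v + (H *: w + x))) - L (g ((s%:C)%C *: v + x)).
have dphiP s : 0 <= s <= h -> is_derive s 1 phi (dphi s).
  move=> sh; apply: is_deriveB.
    exact: (Ld _ _ _ (curve_derive_line (dfk _ _ sh hhh))).
  have := dfk _ _ sh h00; rewrite scale0r add0r => dd.
  exact: (Ld _ _ _ (curve_derive_line dd)).
have cphi : {within `[0, h], continuous phi}.
  apply: derivable_within_continuous => s; rewrite in_itv /= => sh.
  by have [] := dphiP s sh.
have [|s sh] := MVT h0 (df := dphi) _ cphi.
  move=> s; rewrite in_itv /= => /andP[s0 s1]; apply: dphiP.
  by rewrite (ltW s0) ltW.
rewrite in_itv /= in sh; have {}sh : 0 <= s <= h by case/andP: sh => ? ?; rewrite !ltW.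
rewrite {1 2}/phi !scale0r !add0r subr0 -/H => E.
rewrite (_ : L _ - L _ - L _ + L _ = dphi s * h); last first.
  by rewrite -E; ring.
set k1 := (s%:C)%C *: v + H *: w; set k0 := (s%:C)%C *: v.
pose rem k := g (k + x) - g x - 'd g x k.
(* The linear parts at [k1] and [k0] differ exactly by the main term, so only the two remainders
   enter the error. *)
have lin : 'd g x k1 = 'd g x k0 + H * 'd g x w.
  by rewrite /k1 /k0 linearD !linearZ.
have remE : g (k1 + x) - g (k0 + x) = H * ('D_w g x) + (rem k1 - rem k0).
  rewrite /rem lin deriveE//.
  have rg (a b c p q : C) : a - b = q + (a - c - (p + q) - (b - c - p)) by ring.
  exact: rg.
have k1h : `|k1| <= ((h * N)%:C)%C by exact: ltW (sq _ _ sh hhh).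
have k0h : `|k0| <= ((h * N)%:C)%C.
  by have := sq _ _ sh h00; rewrite scale0r addr0 => /ltW.
have small k : `|k| <= ((h * N)%:C)%C -> `|L (rem k)| <= e / 2 * h.
  move=> kh; apply: Ln; apply: le_trans (D1 k _) _.
    by apply: le_lt_trans kh _; rewrite E1 ltcR.
  apply: le_trans (ler_wpM2l (ltW e1) kh) _; rewrite -rmorphM lecR.
  by rewrite mulrCA divfK ?gt_eqF// mulrC.
have -> : dphi s * h - h ^+ 2 * L ('D_w g x) = (L (rem k1) - L (rem k0)) * h.
  have -> : dphi s = h * L ('D_w g x) + (L (rem k1) - L (rem k0)).
    by rewrite -LZ -LB -LD -remE /dphi -LB /k1 addrA.
  ring.
rewrite normrM (ger0_norm (ltW h0)) expr2 mulrA ler_pM2r//.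
apply: le_trans (ler_normB _ _) _.
apply: le_trans (lerD (small _ k1h) (small _ k0h)) _.
by rewrite -mulrDl -splitr.
Qed.

(** The second difference is symmetric in [v] and [w], and by [second_difference] each mixed
    derivative approximates it to order [h ^+ 2]. Real and imaginary parts are compared
    separately. *)
Lemma derive_comm f v w x : (\forall y \near x, differentiable f y) ->
  differentiable ('D_v f) x -> differentiable ('D_w f) x ->
  'D_v ('D_w f) x = 'D_w ('D_v f) x.
Proof.
move=> df dv dw.
have fin (e p q r s a b k : R) : 0 < k ->
    `|p - q - r + s - k * b| <= e / 2 * k ->
    `|p - r - q + s - k * a| <= e / 2 * k -> `|a - b| <= e.
  move=> k0 H1 H2; rewrite -(ler_pM2r k0) -[X in _ * X <= _](gtr0_norm k0) -normrM.
  have -> : (a - b) * k = (p - q - r + s - k * b) - (p - r - q + s - k * a) by ring.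
  apply: le_trans (ler_normB _ _) _; apply: le_trans (lerD H1 H2) _.
  by rewrite -mulrDl -splitr.
have key (L : C -> R) :
    (forall y z, L (y - z) = L y - L z) ->
    (forall (r : R) z, L ((r%:C)%C * z) = r * L z) ->
    (forall z (e : R), `|z| <= (e%:C)%C -> `|L z| <= e) ->
    (forall c (t : R) d, curve_derive c t d -> is_derive t 1 (L \o c) (L d)) ->
    L ('D_v ('D_w f) x) = L ('D_w ('D_v f) x).
  move=> LB LZ Ln Ld; apply/eqP; rewrite -subr_eq0 -normr_le0.
  apply/ler_addgt0Pl => e e0; rewrite addr0.
  have e2 : 0 < e / 2 by rewrite divr_gt0.
  have [d1 d10 D1] := second_difference w LB LZ Ln Ld df dv e2.
  have [d2 d20 D2] := second_difference v LB LZ Ln Ld df dw e2.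
  pose h := Num.min d1 d2 / 2.
  have m0 : 0 < Num.min d1 d2 by rewrite lt_min d10.
  have h0 : 0 < h by rewrite divr_gt0.
  have : h < Num.min d1 d2 by rewrite ltr_pdivrMr// ltr_pMr// ltr1n.
  rewrite lt_min => /andP[hd1 hd2].
  have {}D1 := D1 h; have {}D2 := D2 h.
  rewrite h0 hd1 in D1; rewrite h0 hd2 in D2.
  have {}D1 := D1 isT; have {}D2 := D2 isT.
  (* After this exchange of translations both estimates concern the same second difference. *)
  rewrite [_ *: w + (_ *: v + x)]addrCA in D2.
  have h2 : 0 < h ^+ 2 by rewrite exprn_gt0.
  exact: fin h2 D1 D2.
apply: re_im_inj; apply: key.
- exact: reB.
- by move=> r z; rewrite reM /= mul0r subr0.
- move=> z e ze; rewrite -lecR; apply: le_trans ze; exact: normc_ge_Re.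
- by move=> c t d /curve_deriveP[].
- exact: imB.
- by move=> r z; rewrite imM /= mul0r addr0.
- move=> z e ze; rewrite -lecR; apply: le_trans ze; exact: normc_ge_im.
- by move=> c t d /curve_deriveP[].
Qed.

End MixedDerivatives.

(** * Contour integrals *)

Section ContourIntegrals.
Variable R : realType.
Local Notation C := (Cplx R).

Lemma eq_cint01 (f g : R -> C) : (forall t, 0 <= t <= 1 -> f t = g t) ->
  cint01 f = cint01 g.
Proof.
move=> fg; apply: re_im_inj; rewrite /cint01 /=; apply: eq_Rintegral => t;
  by rewrite inE /= in_itv /= => /fg ->.
Qed.

Lemma continuous_integrable01 (f : R -> R) :
  (forall t, 0 <= t <= 1 -> {for t, continuous f}) ->
  lebesgue_measure.-integrable `[0, 1]%classic (EFin \o f).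
Proof.
move=> cf; apply: continuous_compact_integrable; first exact: segment_compact.
apply: continuous_in_subspaceT => t; rewrite inE /= in_itv /=; exact: cf.
Qed.

(** A complex factor mixes real and imaginary parts, so linearity of the real integral requires both
    to be integrable; continuity on the compact interval ensures it. *)
Lemma cint01Z (k : C) (f : R -> C) :
  (forall t, 0 <= t <= 1 -> {for t, continuous f}) ->
  cint01 (fun t => k * f t) = k * cint01 f.
Proof.
move=> cf.
have ir : lebesgue_measure.-integrable `[0, 1]%classic (EFin \o (@re R \o f)).
  apply: continuous_integrable01 => t /cf ct.
  by have /cvg_complexP[] := ct.
have ii : lebesgue_measure.-integrable `[0, 1]%classic (EFin \o (@im R \o f)).
  apply: continuous_integrable01 => t /cf ct.
  by have /cvg_complexP[] := ct.
have iZ (r : R) g : lebesgue_measure.-integrable `[0, 1]%classic (EFin \o g) ->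
    lebesgue_measure.-integrable `[0, 1]%classic (EFin \o (fun t => r * g t)).
  by move=> ig; apply: eq_integrable (integrableZl _ r ig).
apply: re_im_inj.
  rewrite reM /cint01 /= -!RintegralZl// -RintegralB//; [|exact: iZ|exact: iZ].
  by apply: eq_Rintegral => t _; rewrite reM.
rewrite imM /cint01 /= -!RintegralZl// -RintegralD//; [|exact: iZ|exact: iZ].
by apply: eq_Rintegral => t _; rewrite imM.
Qed.

Lemma C1_arc_derive (c : R -> C) t : C1_arc c -> curve_derive c t (cderiv c t).
Proof. by case=> h1 h2 _ _; exact: cderivP. Qed.

Lemma C1_arc_continuous (c : R -> C) : C1_arc c -> continuous c.
Proof.
move=> [h1 h2 _ _] t; apply/cvg_complexP; split.
  by apply: differentiable_continuous; apply/derivable1_diffP; exact: h1.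
by apply: differentiable_continuous; apply/derivable1_diffP; exact: h2.
Qed.

Lemma C1_arc_cderiv_continuous (c : R -> C) : C1_arc c -> continuous (cderiv c).
Proof. by move=> [_ _ h1 h2] t; apply/cvg_complexP; split; [exact: h1|exact: h2]. Qed.

End ContourIntegrals.

(** Row [i] of [A *m invmx A = 1] has a single term, which yields both the nonvanishing of the
    diagonal and the entries of the inverse. *)
Lemma invmx_diagonal (F : fieldType) n (A : 'M[F]_n) : A \in unitmx ->
  (forall i j, i != j -> A i j = 0) ->
  forall i j, A i i != 0 /\ invmx A i j = if i == j then (A i i)^-1 else 0.
Proof.
move=> uA dA i j.
have E k : A i i * invmx A i k = (i == k)%:R.
  have := congr1 (fun B : 'M[F]_n => B i k) (mulmxV uA); rewrite !mxE => <-.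
  rewrite (bigD1 i)//= big1 ?addr0// => l li.
  by rewrite dA ?mul0r// eq_sym.
have Ai : A i i != 0.
  by apply/eqP => A0; have /eqP := E i; rewrite A0 mul0r eqxx eq_sym oner_eq0.
split=> //; apply: (mulfI Ai); rewrite E.
by case: eqP => _; rewrite ?mulr0// mulfV.
Qed.

(** * Branches of the inverse *)

Section Slices.
Variables (R : realType) (n : nat).
Local Notation C := (Cplx R).
Local Notation Cn := 'rV[C]_n.+1.
Implicit Types (f lam p : C * Cn -> C) (u v : Cn) (l z : C).

Lemma derive_slice f l u v :
  'D_v (fun y => f (l, y)) u = 'D_((0, v) : C * Cn) f (l, u).
Proof.
apply: eq_derive => h.
rewrite (_ : _ + (l, u) = (h *: 0 + l, h *: v + u))//.
by rewrite scaler0 add0r.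
Qed.

Lemma derive_slice1 f l u :
  'D_1 (fun z : C => f (z, u)) l = dp f (l, u).
Proof.
apply: eq_derive => h.
rewrite (_ : _ + (l, u) = (h *: 1 + l, h *: 0 + u))//.
by rewrite scaler0 add0r.
Qed.

(** Holomorphy is stated through iterated derivatives; those of a slice are iterated derivatives of
    [f] along vectors with first component 0, so slices stay holomorphic. *)
Lemma itderive_slice f l (s : seq Cn) :
  itderive s (fun y => f (l, y)) =
  (fun y => itderive [seq (0, v) : C * Cn | v <- s] f (l, y)).
Proof.
elim: s => [//|v s IH]; rewrite /itderive /= -/(itderive s _) IH.
by apply: boolp.funext => y; rewrite derive_slice.
Qed.

Lemma differentiable_slice f l u : differentiable f (l, u) ->
  differentiable (fun y => f (l, y)) u.
Proof.
by move=> df; apply: (@differentiable_comp _ _ _ _ (fun y : Cn => (l, y)) f).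
Qed.

Lemma differentiable_slice1 f l u : differentiable f (l, u) ->
  differentiable (fun z : C => f (z, u)) l.
Proof.
by move=> df; apply: (@differentiable_comp _ _ _ _ (fun z : C => (z, u)) f).
Qed.

Lemma holo_on_slice (B : set (C * Cn)) f l : holo_on B f ->
  holo_on [set y | B (l, y)] (fun y => f (l, y)).
Proof.
by move=> hf s y By; rewrite itderive_slice; apply: differentiable_slice; exact: hf.
Qed.

Lemma open_slice (B : set (C * Cn)) l : open B -> open [set y | B (l, y)].
Proof.
move=> oB; apply: (@open_comp _ _ (fun y : Cn => (l, y)) B) => // y _.
exact: differentiable_continuous.
Qed.

Lemma holo_differentiable (V : normedModType C) (U : set V) (f : V -> C) (x : V) :
  holo_on U f -> U x -> differentiable f x.
Proof. by move=> hf Ux; exact: (hf [::]). Qed.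

Lemma holo_derive (V : normedModType C) (U : set V) (f : V -> C) (v : V) :
  holo_on U f -> holo_on U ('D_v f).
Proof. by move=> hf s x Ux; have := hf (rcons s v) x Ux; rewrite /itderive foldr_rcons. Qed.

(** Implicit differentiation: [lam (p (l, y), y)] is constantly [l] for [y] near [u], so its
    derivative along the coordinate vector [i] vanishes. *)
Lemma derive_inverse_branch (Om : set (C * Cn)) lam B p l u i :
  holo_on Om lam -> inverse_branch Om lam B p -> B (l, u) ->
  dp lam (p (l, u), u) * dpinv i p l u = - du i lam (p (l, u), u).
Proof.
move=> hlam [oB hp Bp] Bu.
have [Omu _] := Bp _ _ Bu.
have dlam := holo_differentiable hlam Omu.
have dpl := differentiable_slice (holo_differentiable hp Bu).
set q := fun y => p (l, y) in dpl.
have dq : differentiable (fun y : Cn => (q y, y)) u by exact: differentiable_pair.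
pose e : Cn := delta_mx 0 i.
have : 'D_e (fun y => lam (q y, y)) u = 0.
  rewrite (@near_eq_derive _ _ _ _ (cst l)) ?derive_cst//.
  have := @open_slice B l oB; rewrite openE => /(_ _ Bu) /=.
  by apply: filterS => y /Bp[].
rewrite deriveE; last exact: (@differentiable_comp _ _ _ _ (fun y : Cn => (q y, y)) lam).
rewrite (@diff_comp _ _ _ _ (fun y : Cn => (q y, y)) lam)//=.
rewrite (@diff_pair _ _ _ _ q id)//= -!deriveE//= derive_id => E.
(* Splits the velocity of [(q y, y)] into its part along the variable of [dp] and its part along
   that of [du]. *)
have dec : ((('D_e q u), e) : C * Cn) = ('D_e q u) *: ((1, 0) : C * Cn) + (0, e).
  rewrite (_ : _ + _ = ('D_e q u * 1 + 0, 'D_e q u *: 0 + e))//.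
  by rewrite mulr1 addr0 scaler0 add0r.
move: E; rewrite deriveE// dec linearD linearZ -!deriveE// => /eqP.
by rewrite addr_eq0 mulrC => /eqP.
Qed.

End Slices.

(** With [z] for [lam_p]: two implicit derivatives divide by [lam_p] twice, and [dl = lam_p dp]
    restores one factor. *)
Lemma divff_cancel (F : fieldType) (x y z w : F) : z != 0 ->
  - x / z * (- y / z) * (z * w) = x * y / z * w.
Proof. by move=> z0; field. Qed.

(** * Change of variable [l = lam p] in the residue integrals *)

Section SuperpotentialContours.
Variables (R : realType) (n : nat) (M : frobenius_manifold R n) (a : chart M).
Variable S : superpotential a.
Local Notation C := (Cplx R).
Local Notation Cn := 'rV[C]_n.+1.
Variables (u : Cn) (Gam : 'I_n.+1 -> contour R).
Hypothesis small : forall k,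
  small_contour (sp_dom S) (lam S) u (crit S k u) (Gam k).

Let integrand (c : R -> C) (i j : 'I_n.+1) (t : R) : C :=
  du i (lam S) (c t, u) * du j (lam S) (c t, u) / dp (lam S) (c t, u)
  * cderiv c t.

Lemma small_contour_arc k s t : (s < narc (Gam k))%N -> 0 <= t <= 1 ->
  sp_dom S (Defs.arc (Gam k) s t, u) /\ dp (lam S) (Defs.arc (Gam k) s t, u) != 0.
Proof.
move=> sk t01; have [_ _ [r r0 [disc near_crit]]] := small k.
have /andP[h1 h2] := near_crit _ _ sk t01.
have [h3 h4] := disc _ h2; split=> //; apply: h4.
by rewrite -subr_eq0 -normr_gt0.
Qed.

Lemma small_contour_C1 k s : (s < narc (Gam k))%N -> C1_arc (Defs.arc (Gam k) s).
Proof. by move=> sk; have [/(_ _ sk)[]] := small k. Qed.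

(** Provides the integrability behind [cint01Z]; the quotient is continuous because [lam_p] has no
    zero on the contour. *)
Lemma continuous_integrand k s i j t : (s < narc (Gam k))%N -> 0 <= t <= 1 ->
  {for t, continuous (integrand (Defs.arc (Gam k) s) i j)}.
Proof.
move=> sk t01; have [Om dp0] := small_contour_arc sk t01.
set c := Defs.arc (Gam k) s in Om dp0 *; have c1 : C1_arc c := small_contour_C1 sk.
have comp (g : C * Cn -> C) : differentiable g (c t, u) ->
    {for t, continuous (fun s : R => g (c s, u))}.
  move=> dg; have dg1 := differentiable_continuous (differentiable_slice1 dg).
  exact: (continuous_comp (@C1_arc_continuous R c c1 t) dg1).
have hl := @sp_holo _ _ _ _ S.
have du_cvg m := comp _ (holo_differentiable (holo_derive _ hl) Om : differentiable (du m (lam S)) _).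
have dp_cvg := comp _ (holo_differentiable (holo_derive _ hl) Om : differentiable (dp (lam S)) _).
have ft := nbhs_filter (t : R).
have numE := @cvgM C _ _ ft _ _ _ _ (du_cvg i) (du_cvg j).
have quotE := @cvgM C _ _ ft _ _ _ _ numE (@cvgV C _ _ ft _ _ dp0 dp_cvg).
exact: (@cvgM C _ _ ft _ _ _ _ quotE (@C1_arc_cderiv_continuous R c c1 t)).
Qed.

Lemma cderiv_superpotential k s t : (s < narc (Gam k))%N -> 0 <= t <= 1 ->
  cderiv ((fun p => lam S (p, u)) \o Defs.arc (Gam k) s) t =
  dp (lam S) (Defs.arc (Gam k) s t, u) * cderiv (Defs.arc (Gam k) s) t.
Proof.
move=> sk t01; have [Om _] := small_contour_arc sk t01.
rewrite -derive_slice1; apply: curve_derive_cderiv.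
apply: (@curve_derive_comp R (fun p : C => lam S (p, u))).
  by apply: differentiable_slice1; exact: holo_differentiable (@sp_holo _ _ _ _ S) Om.
exact: C1_arc_derive (small_contour_C1 sk).
Qed.

Variable P : 'I_n.+1 -> nat -> R -> C * Cn -> C.
Hypothesis branches : branches_on S u Gam P.

(** The substitution [l = lam p] holds pointwise in the parameter: at each point of the image the
    branch returns the point of the contour, where the implicit derivatives are evaluated. *)
Lemma branch_integrand k s t i j : (s < narc (Gam k))%N -> 0 <= t <= 1 ->
  let l := lam S (Defs.arc (Gam k) s t, u) in
  dpinv i (P k s t) l u * dpinv j (P k s t) l u
    * cderiv ((fun p => lam S (p, u)) \o Defs.arc (Gam k) s) t
  = integrand (Defs.arc (Gam k) s) i j t.
Proof.
move=> sk t01 l; have [Om dp0] := small_contour_arc sk t01.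
have [B iB [Bl Pl]] := branches sk t01.
have E m := @derive_inverse_branch _ _ _ _ _ _ _ _ m (@sp_holo _ _ _ _ S) iB Bl.
rewrite Pl in E; rewrite cderiv_superpotential// /integrand.
have {}E m : dpinv m (P k s t) l u = - du m (lam S) (Defs.arc (Gam k) s t, u)
    / dp (lam S) (Defs.arc (Gam k) s t, u).
  by rewrite -E mulrAC mulfV ?mul1r.
rewrite !E; exact: divff_cancel.
Qed.

(** The factor [w] serves both expansions: [w = 1] for the covariant components,
    [w = 1 / (eta_ii eta_jj)] for the contravariant ones. *)
Lemma int_over_C_scale (w : C) i j :
  int_over_C S u Gam P (fun p l => w * (dpinv i p l u * dpinv j p l u)) =
  w * \sum_k contour_int (Gam k) (fun p =>
        du i (lam S) (p, u) * du j (lam S) (p, u) / dp (lam S) (p, u)).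
Proof.
rewrite /int_over_C mulr_sumr; apply: eq_bigr => k _.
rewrite /contour_int /image_int mulr_sumr; apply: eq_bigr => -[s sk] _ /=.
rewrite -(@cint01Z R w (integrand (Defs.arc (Gam k) s) i j)); last first.
  by move=> t; exact: continuous_integrand.
apply: eq_cint01 => t t01; rewrite -mulrA; congr (_ * _).
exact: branch_integrand.
Qed.

End SuperpotentialContours.

(** * The metric in canonical coordinates and its quadratic expansions *)

Section CanonicalMetric.
Variables (R : realType) (n : nat) (M : frobenius_manifold R n) (a : chart M).
Hypothesis ha : canonical_chart a.
Local Notation C := (Cplx R).
Local Notation Cn := 'rV[C]_n.+1.
Implicit Types x : Cn.

Lemma lower3_canonical x i j k : chart_img a x ->
  lower3 (fm_eta a) (fm_mult a) x i j k = (i == j)%:R * fm_eta a x j k.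
Proof.
move=> xa; rewrite /lower3 (bigD1 j)//= big1 ?addr0.
  by rewrite ha.1// eqxx andbT.
by move=> l lj; rewrite ha.1// [j == l]eq_sym (negbTE lj) andbF mul0r.
Qed.

(** By symmetry of [c], [eta_ij = c(d_i, d_i, d_j) = c(d_i, d_j, d_i)], and the last term vanishes
    because [d_i . d_j = 0]. *)
Lemma eta_canonical_diag x i j : chart_img a x -> i != j -> fm_eta a x i j = 0.
Proof.
move=> xa ij; have [_] := c_sym xa i i j.
by rewrite !lower3_canonical// eqxx (negbTE ij) mul1r mul0r.
Qed.

Lemma eta_canonical_neq0 x i : chart_img a x -> fm_eta a x i i != 0.
Proof.
move=> xa; have [|//] := @invmx_diagonal _ _ _ (eta_unit xa) _ i i.
by move=> j k; exact: eta_canonical_diag.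
Qed.

Lemma etaup_canonical x i j : chart_img a x ->
  etaup a x i j = if i == j then (fm_eta a x i i)^-1 else 0.
Proof.
move=> xa; have [|//] := @invmx_diagonal _ _ _ (eta_unit xa) _ i j.
by move=> k l; exact: eta_canonical_diag.
Qed.

End CanonicalMetric.

Lemma quadratic_expansions (R : realType) (n : nat) (M : frobenius_manifold R n)
    (a : chart M) (ha : canonical_chart a) (S : superpotential a)
    (u : 'rV[Cplx R]_n.+1) (Gam : 'I_n.+1 -> contour R)
    (P : 'I_n.+1 -> nat -> R -> Cplx R * 'rV[Cplx R]_n.+1 -> Cplx R) :
  chart_img a u ->
  (forall k, small_contour (sp_dom S) (lam S) u (crit S k u) (Gam k)) ->
  branches_on S u Gam P -> forall i j : 'I_n.+1,
  fm_eta a u i j = - (twopii R)^-1 * int_over_C S u Gam P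
                       (fun p l => dpinv i p l u * dpinv j p l u) /\
  etaup a u i j = - (twopii R)^-1 * int_over_C S u Gam P
                       (fun p l => Wfun a i p l u * Wfun a j p l u).
Proof.
move=> ua small branches i j.
have E w : - (twopii R)^-1 * int_over_C S u Gam P
    (fun p l => w * (dpinv i p l u * dpinv j p l u)) = w * fm_eta a u i j.
  by rewrite int_over_C_scale// mulrCA -(sp_contour ua small).
split; first by rewrite -[LHS]mul1r -E; congr (_ * int_over_C _ _ _ _ _);
  apply: boolp.funext => p; apply: boolp.funext => l; rewrite mul1r.
have -> : (fun p l => Wfun a i p l u * Wfun a j p l u) =
    (fun p l => (fm_eta a u i i * fm_eta a u j j)^-1 * (dpinv i p l u * dpinv j p l u)).
  apply: boolp.funext => p; apply: boolp.funext => l.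
  by rewrite /Wfun mulrACA -invfM mulrC.
(* What remains is [eta_ij / (eta_ii eta_jj) = eta^ij], true for a diagonal metric. *)
rewrite E etaup_canonical//; case: eqVneq => [->|ij].
  by rewrite invfM divfK ?eta_canonical_neq0.
by rewrite (eta_canonical_diag ha ua ij) mulr0.
Qed.

(** * Partial derivatives and generic points *)

Section PartialDerivatives.
Variables (R : realType) (n : nat).
Local Notation C := (Cplx R).
Local Notation Cn := 'rV[C]_n.+1.
Implicit Types (f g : Cn -> C) (x : Cn) (U : set Cn) (i j : 'I_n.+1).

Lemma eq_pd U f g x i : open U -> U x -> (forall y, U y -> f y = g y) ->
  pd i f x = pd i g x.
Proof.
move=> oU Ux fg; apply: near_eq_derive.
by move: oU; rewrite openE => /(_ _ Ux); apply: filterS => y /fg.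
Qed.

Lemma eq_derivable U f g x v : open U -> U x -> (forall y, U y -> f y = g y) ->
  derivable f x v -> derivable g x v.
Proof.
move=> oU Ux fg; apply: near_eq_derivable.
by move: oU; rewrite openE => /(_ _ Ux); apply: filterS => y /fg.
Qed.

Lemma pd_cst U f x i c : open U -> U x -> (forall y, U y -> f y = c) -> pd i f x = 0.
Proof. by move=> oU Ux fc; rewrite (eq_pd _ oU Ux (g := cst c))// /pd derive_cst. Qed.

Let e i : Cn := delta_mx 0 i.

Lemma pdB f g x i : derivable f x (e i) -> derivable g x (e i) ->
  pd i (fun y => f y - g y) x = pd i f x - pd i g x.
Proof. by move=> df dg; exact: deriveB df dg. Qed.

Lemma pdM f g x i : derivable f x (e i) -> derivable g x (e i) ->
  pd i (fun y => f y * g y) x = pd i f x * g x + f x * pd i g x.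
Proof.
move=> df dg; have := deriveM df dg.
by rewrite addrC [_ *: 'D__ f x]mulrC.
Qed.

Lemma pd_div f g x i : derivable f x (e i) -> derivable g x (e i) -> g x != 0 ->
  pd i (fun y => f y / g y) x = pd i f x / g x - f x * pd i g x / g x ^+ 2.
Proof.
move=> df dg g0; rewrite (pdM df (derivableV g0 dg)).
have E : pd i (fun y => (g y)^-1) x = - (g x) ^- 2 * pd i g x := deriveV g0 dg.
by rewrite E mulNr mulrN [_ ^- 2 * _]mulrC mulrA.
Qed.

Lemma pd_sum (F : 'I_n.+1 -> Cn -> C) x i :
  (forall m, derivable (F m) x (e i)) ->
  pd i (fun y => \sum_m F m y) x = \sum_m pd i (F m) x.
Proof.
move=> dF; rewrite -[RHS](derive_sum dF) /pd.
rewrite (_ : (fun y => _) = \sum_m F m)//.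
by apply: boolp.funext => y; rewrite fct_sumE.
Qed.

(** In canonical coordinates the sum of the coordinate vectors is the unit field. *)
Lemma derive_ones f x : differentiable f x ->
  'D_(\sum_i e i) f x = \sum_i pd i f x.
Proof.
move=> df; rewrite deriveE// linear_sum.
by apply: eq_bigr => i _; rewrite /pd deriveE.
Qed.

Lemma open_nonzero U f : open U -> (forall x, U x -> {for x, continuous f}) ->
  open (U `&` [set x | f x != 0]).
Proof.
move=> oU cf; rewrite openE => x [Ux fx]; apply: filterI.
  by move: oU; rewrite openE => /(_ _ Ux).
exact: (cvgr_neq0 (f x) (cf x Ux) fx).
Qed.

(* Where the first function does not vanish identically, restrict to an open
   set on which it has no zero; its derivative forbids the other case. *)
Lemma common_nonzero (T : eqType) (s : seq T) (F : T -> Cn -> C) U (v : Cn) :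
  open U -> U !=set0 ->
  (forall t y, t \in s -> U y -> differentiable (F t) y /\ 'D_v (F t) y = 1) ->
  exists2 y, U y & forall t, t \in s -> F t y != 0.
Proof.
elim: s U => [|t s IH] U oU U0 dF; first by have [y Uy] := U0; exists y.
have [y Uy Fty] : exists2 y, U y & F t y != 0.
  apply: contrapT => H; have [y Uy] := U0.
  have [_ /eqP] := dF t y (mem_head _ _) Uy.
  rewrite (@near_eq_derive _ _ _ _ (cst 0)) ?derive_cst 1?eq_sym ?oner_eq0//.
  move: oU; rewrite openE => /(_ _ Uy); apply: filterS => z Uz.
  by apply: contrapT => /eqP Fz; apply: H; exists z.
pose U' := U `&` [set z | F t z != 0].
have oU' : open U'.
  apply: open_nonzero => // z Uz; apply: differentiable_continuous.
  by have [] := dF t z (mem_head _ _) Uz.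
have [||z [Uz Fz] Hz] := IH U' oU'; first by exists y.
  by move=> r z rs [Uz _]; apply: dF; rewrite // in_cons rs orbT.
by exists z => // r; rewrite in_cons => /predU1P[->//|]; exact: Hz.
Qed.

End PartialDerivatives.

(** * Diagonal metrics *)

Lemma sumD (V : nmodType) n (F G : 'I_n -> V) :
  \sum_i (F i + G i) = \sum_i F i + \sum_i G i.
Proof. exact: big_split. Qed.

Lemma sum_two (V : nmodType) n (F : 'I_n -> V) i j : i != j ->
  (forall k, k != i -> k != j -> F k = 0) -> \sum_k F k = F i + F j.
Proof.
move=> ij F0; rewrite (bigD1 i)//= (bigD1 j) 1?eq_sym//= big1 ?addr0//.
by move=> k /andP[]; exact: F0.
Qed.

Lemma mulr_sumB (F : comNzRingType) n (b a : F) (g h z : 'I_n -> F) :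
  \sum_p (b * g p - a * h p) * z p =
  b * (\sum_p g p * z p) - a * (\sum_p h p * z p).
Proof. by rewrite !mulr_sumr -sumrB; apply: eq_bigr => p _; rewrite mulrBl !mulrA. Qed.

(** The index bookkeeping of the Codazzi equations: once the double sum is exchanged, the
    coefficient of [z p] is the opposite of the hypothesis at [p], which there is a curvature
    component. *)
Lemma sum_curvature (F : comNzRingType) n (S z a b da db : 'I_n -> F)
    (g h : 'I_n -> 'I_n -> F) :
  (forall p, da p - db p + \sum_m (h p m * a m - g p m * b m) = 0) ->
  \sum_m (S m + ((db m - da m) * z m + \sum_p (b m * g p m - a m * h p m) * z p))
  = \sum_m S m.
Proof.
move=> flat; rewrite sumD sumD exchange_big -sumD [X in _ + X]big1 ?addr0// => p _.
rewrite -mulr_suml -mulrDl -[db p - da p]opprB -[X in _ + X]opprK -opprD -sumrN.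
rewrite (eq_bigr (fun m => h p m * a m - g p m * b m)) ?flat ?oppr0 ?mul0r// => m _.
by rewrite opprB; congr (_ - _); rewrite mulrC.
Qed.

Section DiagonalMetric.
Variables (R : realType) (n : nat).
Local Notation C := (Cplx R).
Local Notation Cn := 'rV[C]_n.+1.
Variables (U : set Cn) (G : Cn -> 'M[C]_n.+1).
Hypothesis oU : open U.
Hypothesis G_diag : forall x, U x -> forall i j, i != j -> G x i j = 0.
Hypothesis G_unit : forall x, U x -> G x \in unitmx.
Implicit Types (x : Cn) (f : Cn -> C) (i j k : 'I_n.+1).

(* The derivative of [ln (sqrt (G i i))] in the direction [j]. *)
Definition lame x i j : C := pd j (fun y => G y i i) x / (2 * G x i i).

(** The metric enters only through [lame], so diagonal metrics with the same off-diagonal [lame]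
    share this expression; [eta] and [g] are compared in this way. *)
Definition offdiag_hess f x i j : C :=
  pd i (pd j f) x - lame x i j * pd i f x - lame x j i * pd j f x.

Lemma diag_neq0 x i : U x -> G x i i != 0.
Proof. by move=> Ux; have [] := invmx_diagonal (G_unit Ux) (G_diag Ux) i i. Qed.

Lemma pd_offdiag x i j k : U x -> i != j -> pd k (fun y => G y i j) x = 0.
Proof. by move=> Ux ij; apply: (pd_cst k oU Ux) => y Uy; exact: G_diag. Qed.

Lemma christoffel_diag x k i j : U x -> christoffel G x k i j =
  (pd i (fun y => G y k j) x + pd j (fun y => G y k i) x
   - pd k (fun y => G y i j) x) / (2 * G x k k).
Proof.
move=> Ux; rewrite /christoffel (bigD1 k)//= big1 ?addr0; last first.
  move=> l lk; have [_ ->] := invmx_diagonal (G_unit Ux) (G_diag Ux) k l.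
  by rewrite eq_sym (negbTE lk) mul0r.
have [_ ->] := invmx_diagonal (G_unit Ux) (G_diag Ux) k k.
by rewrite eqxx invfM mulrA mulrC.
Qed.

Lemma christoffel_iij x i j : U x -> i != j -> christoffel G x i i j = lame x i j.
Proof.
by move=> Ux ij; rewrite christoffel_diag// (@pd_offdiag x i j)// add0r subr0.
Qed.

Lemma christoffel_iji x i j : U x -> i != j -> christoffel G x i j i = lame x i j.
Proof.
move=> Ux ij; rewrite christoffel_diag// (@pd_offdiag x i j)// (@pd_offdiag x j i) 1?eq_sym//.
by rewrite addr0 subr0.
Qed.

Lemma christoffel_jii x i j : U x -> i != j ->
  christoffel G x j i i = - pd j (fun y => G y i i) x / (2 * G x j j).
Proof.
by move=> Ux ij; rewrite christoffel_diag// (@pd_offdiag x j i) 1?eq_sym// !add0r.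
Qed.

Lemma christoffel_distinct x i j k : U x -> i != j -> k != i -> k != j ->
  christoffel G x k i j = 0.
Proof.
by move=> Ux ij ki kj; rewrite christoffel_diag// !pd_offdiag// addr0 subr0 mul0r.
Qed.

(** For a diagonal metric the Christoffel symbols with three distinct indices vanish, so only the
    terms with upper index [i] or [j] remain. *)
Lemma hess_offdiag f x i j : U x -> i != j -> hess G f x i j = offdiag_hess f x i j.
Proof.
move=> Ux ij; have ji : j != i by rewrite eq_sym.
rewrite mxE (sum_two ij) => [|k ki kj]; last by rewrite christoffel_distinct ?mul0r.
rewrite (christoffel_iij Ux ij) (christoffel_iji Ux ji).
by rewrite opprD addrA.
Qed.

(** The closed formula for diagonal metrics removes [invmx], leaving a quotient of holomorphic
    functions with nonzero denominator. *)
Lemma derivable_christoffel x k i j v : U x ->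
  (forall p q, holo_on U (fun y => G y p q)) ->
  derivable (fun y => christoffel G y k i j) x v.
Proof.
move=> Ux hG.
have dG p q m : differentiable (pd m (fun y => G y p q)) x.
  exact: holo_differentiable (holo_derive _ (hG p q)) Ux.
apply: (eq_derivable (U := U)
  (f := fun y => (pd i (fun y => G y k j) y + pd j (fun y => G y k i) y
    - pd k (fun y => G y i j) y) / (2 * G y k k))) => //.
  by move=> y Uy; rewrite christoffel_diag.
apply: derivableM.
  by apply: derivableB; [apply: derivableD|]; exact: diff_derivable.
apply: derivableV; first by rewrite mulf_neq0 ?pnatr_eq0 ?diag_neq0.
apply: derivableM; first exact: derivable_cst.
by apply: diff_derivable; exact: holo_differentiable (hG k k) Ux.
Qed.

End DiagonalMetric.

(** * Codazzi equations for the Hessian of a function in a flat metric *)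

Section Codazzi.
Variables (R : realType) (n : nat).
Local Notation C := (Cplx R).
Local Notation Cn := 'rV[C]_n.+1.
Variables (U : set Cn) (G : Cn -> 'M[C]_n.+1) (x : Cn).
Hypotheses (oU : open U) (Ux : U x).
Hypothesis dG : forall k i j v, derivable (fun y => christoffel G y k i j) x v.
Hypothesis flat : forall k l i j, riemann G x k l i j = 0.

Lemma derivable_christoffel_pd f p q v : holo_on U f ->
  derivable (fun y => \sum_m christoffel G y m p q * pd m f y) x v.
Proof.
move=> hf.
have dm m : derivable (fun y => christoffel G y m p q * pd m f y) x v.
  apply: derivableM (@dG m p q _) _; apply: diff_derivable.
  exact: holo_differentiable (holo_derive _ hf) Ux.
have := derivable_sum dm; rewrite (_ : \sum_m _ = fun y =>
  \sum_m christoffel G y m p q * pd m f y)//.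
by apply: boolp.funext => y; rewrite fct_sumE.
Qed.

Lemma derivable_hess f p q v : holo_on U f ->
  derivable (fun y => hess G f y p q) x v.
Proof.
move=> hf; rewrite (_ : (fun y => _) = fun y => pd p (pd q f) y
  - \sum_m christoffel G y m p q * pd m f y); last first.
  by apply: boolp.funext => y; rewrite mxE.
apply: derivableB; last exact: derivable_christoffel_pd.
apply: diff_derivable.
exact: holo_differentiable (holo_derive _ (holo_derive _ hf)) Ux.
Qed.

(* The third partial derivatives cancel; the remaining terms add up to the
   curvature. *)
Lemma codazzi f i j k : holo_on U f ->
  pd k (fun y => hess G f y i j) x - pd i (fun y => hess G f y k j) x =
  \sum_m (christoffel G x m k j * hess G f x i m
          - christoffel G x m i j * hess G f x k m).
Proof.
move=> hf.
have hd m : holo_on U (pd m f) by exact: holo_derive.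
have hdd m p : holo_on U (pd p (pd m f)) by exact: holo_derive.
have dd g m : holo_on U g -> derivable g x (delta_mx 0 m).
  by move=> hg; apply: diff_derivable; exact: holo_differentiable hg Ux.
have E p q r : pd r (fun y => hess G f y p q) x = pd r (pd p (pd q f)) x -
    \sum_m (pd r (fun y => christoffel G y m p q) x * pd m f x
            + christoffel G x m p q * pd r (pd m f) x).
  rewrite (_ : (fun y => _) = fun y => pd p (pd q f) y
    - \sum_m christoffel G y m p q * pd m f y); last first.
    by apply: boolp.funext => y; rewrite mxE.
  have dm m : derivable (fun y => christoffel G y m p q * pd m f y) x (delta_mx 0 r).
    exact: derivableM (@dG m p q _) (dd _ r (hd m)).
  have ds := @derivable_christoffel_pd f p q (delta_mx 0 r) hf.
  rewrite (pdB (dd _ _ (hdd q p)) ds) (pd_sum dm); congr (_ - _).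
  by apply: eq_bigr => m _; exact: pdM (@dG m p q _) (dd _ r (hd m)).
have S3 : pd k (pd i (pd j f)) x = pd i (pd k (pd j f)) x.
  apply: derive_comm; last 2 first.
  - exact: holo_differentiable (hdd j k) Ux.
  - exact: holo_differentiable (hdd j i) Ux.
  move: oU; rewrite openE => /(_ _ Ux); apply: filterS => y Uy.
  exact: holo_differentiable (hd j) Uy.
have H p q : pd p (pd q f) x = hess G f x p q + \sum_m christoffel G x m p q * pd m f x.
  rewrite [hess _ _ _ _ _]mxE; exact/esym/subrK.
have alg (X Y D D' A B : C) : X = D - A -> Y = D' - B -> D = D' -> X - Y = B - A.
  by move=> -> -> ->; ring.
transitivity (\sum_m (pd i (fun y => christoffel G y m k j) x * pd m f x
      + christoffel G x m k j * pd i (pd m f) x)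
    - \sum_m (pd k (fun y => christoffel G y m i j) x * pd m f x
      + christoffel G x m i j * pd k (pd m f) x)).
  exact: alg (E i j k) (E k j i) S3.
rewrite -sumrB.
(* [S] is the claimed right-hand side. Replacing second partial derivatives by Hessian entries
   through [H] leaves [D] and [Q], the derivative and quadratic parts of the curvature. *)
pose S m := christoffel G x m k j * hess G f x i m - christoffel G x m i j * hess G f x k m.
pose D m := (pd i (fun y => christoffel G y m k j) x
  - pd k (fun y => christoffel G y m i j) x) * pd m f x.
pose Q m p := (christoffel G x m k j * christoffel G x p i m
  - christoffel G x m i j * christoffel G x p k m) * pd p f x.
transitivity (\sum_m (S m + (D m + \sum_p Q m p))).
  apply: eq_bigr => m _.
  have QE : \sum_p Q m p = christoffel G x m k j * (\sum_p christoffel G x p i m * pd p f x)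
      - christoffel G x m i j * (\sum_p christoffel G x p k m * pd p f x).
    exact: mulr_sumB.
  have alg2 (b b' a a' z t t' s s' X Y q : C) : X = t + s -> Y = t' + s' ->
      q = b * s - a * s' ->
      b' * z + b * X - (a' * z + a * Y) = b * t - a * t' + ((b' - a') * z + q).
    by move=> -> -> ->; ring.
  exact: alg2 (H i m) (H k m) QE.
apply: sum_curvature => p.
exact: flat p j k i.
Qed.

End Codazzi.

(** * Canonical coordinates *)

Lemma sum_one (V : nmodType) n (F : 'I_n -> V) i :
  (forall k, k != i -> F k = 0) -> \sum_k F k = F i.
Proof. by move=> F0; rewrite (bigD1 i)//= big1 ?addr0. Qed.

Section CanonicalGeometry.
Variables (R : realType) (n : nat) (M : frobenius_manifold R n) (a : chart M).
Hypothesis ha : canonical_chart a.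
Local Notation C := (Cplx R).
Local Notation Cn := 'rV[C]_n.+1.
Local Notation X := (chart_img a).
Local Notation eta := (fm_eta a).
Local Notation E := (fm_euler a).
Implicit Types (x : Cn) (f : Cn -> C) (i j k : 'I_n.+1) (U : set Cn).

Let oX : open X := @img_open _ _ M a.
Let eta_diag x (Xx : X x) i j (ij : i != j) : eta x i j = 0 :=
  eta_canonical_diag ha Xx ij.
Let etaU x (Xx : X x) : eta x \in unitmx := eta_unit Xx.
Let eta0 x (Xx : X x) i : eta x i i != 0 := eta_canonical_neq0 ha i Xx.

Lemma two_neq0 : (2 : C) != 0. Proof. by rewrite pnatr_eq0. Qed.

(** For [i != j] this is [nabla_j c_iij = nabla_i c_jij]: both components of [c] vanish identically,
    so only Christoffel terms survive, and the two sides become [d_i eta_jj / 2] and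
    [d_j eta_ii / 2]. *)
Lemma egorov x i j : X x ->
  pd j (fun y => eta y i i) x = pd i (fun y => eta y j j) x.
Proof.
move=> Xx; have [->//|ij] := eqVneq i j; have ji : j != i by rewrite eq_sym.
have [H _ _] := nabla_c_sym Xx j i i j.
have T p q r : lower3 eta (fm_mult a) x p q r = (p == q)%:R * eta x q r.
  exact: lower3_canonical.
have L : nabla3 eta (lower3 eta (fm_mult a)) x j i i j =
    - (christoffel eta x i j j * eta x i i).
  rewrite /nabla3 (pd_cst _ oX Xx (c := 0)); last first.
    by move=> y Xy; rewrite lower3_canonical// eta_diag ?mulr0.
  move: (christoffel eta x) => Gam; rewrite sub0r; congr (- _); rewrite (sum_one (i := i)).
    by rewrite !T eqxx !mul1r (eta_diag Xx ij) !mulr0 !add0r.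
  move=> k ki; rewrite !T [i == k]eq_sym (negbTE ki) !mul0r !mulr0.
  by rewrite eta_diag ?mulr0 ?addr0// eq_sym.
have Rr : nabla3 eta (lower3 eta (fm_mult a)) x i j i j =
    - (christoffel eta x j i i * eta x j j).
  rewrite /nabla3 (pd_cst _ oX Xx (c := 0)); last first.
    by move=> y Xy; rewrite lower3_canonical// (negbTE ji) mul0r.
  move: (christoffel eta x) => Gam; rewrite sub0r; congr (- _); rewrite (sum_one (i := j)).
    by rewrite !T eqxx (negbTE ji) !mul0r !mulr0 mul1r add0r addr0.
  move=> k kj; rewrite !T [j == k]eq_sym (negbTE kj) (negbTE ji).
  by rewrite (eta_diag Xx ij) !mul0r !mulr0 !addr0.
move: H; rewrite L Rr => /oppr_inj.
rewrite (christoffel_jii oX eta_diag etaU Xx ij) (christoffel_jii oX eta_diag etaU Xx ji).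
have alg (p q s t : C) : s != 0 -> t != 0 ->
    - p / (2 * s) * s = - q / (2 * t) * t -> q = p.
  move=> s0 t0; have E2 (r w : C) : w != 0 -> - r / (2 * w) * w = - r / 2.
    by move=> w0; rewrite invfM mulrA divfK.
  by rewrite !E2// => /(mulIf (invr_neq0 two_neq0)) /oppr_inj.
exact: alg (eta0 Xx i) (eta0 Xx j).
Qed.

(** The structure constants are constant functions, so the [k]-th component of [L_E(.) = .] on the
    pair [(d_i, d_i)] reads [- d_i E^k + 2 delta_ik d_i E^i = delta_ik]. *)
Lemma euler_derive x i k : X x -> pd i (fun y => E y k) x = (i == k)%:R.
Proof.
move=> Xx.
have [d dE] : exists d, forall p q, d p q = pd p (fun y => E y q) x.
  by exists (fun p q => pd p (fun y => E y q) x).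
have H : \sum_l (- ((i == l)%:R * d l k) + ((l == i) && (i == k))%:R * d i l
    + ((i == l) && (l == k))%:R * d i l) = (i == k)%:R.
  have -> : (i == k)%:R = fm_mult a x i i k by rewrite ha.1// eqxx.
  rewrite -(euler_mult Xx i i k); apply: eq_bigr => l _; rewrite !dE !ha.1// eqxx.
  have alg (e c p q r : C) : c = 0 -> - p + q + r = e * c - p + q + r.
    by move=> ->; rewrite mulr0 sub0r.
  apply: alg; apply: (pd_cst l oX Xx) => y Xy; rewrite ha.1//.
rewrite -dE; move: H; rewrite (sum_one (i := i)); last first.
  by move=> l li; rewrite [i == l]eq_sym (negbTE li) /= !mul0r oppr0 !addr0.
rewrite eqxx /= mul1r; case: eqVneq => [->|_]; first by rewrite mul1r addNr add0r.
by rewrite mul0r !addr0 => /eqP; rewrite oppr_eq0 => /eqP.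
Qed.

Lemma euler_differentiable x k : X x -> differentiable (fun y => E y k) x.
Proof. by move=> Xx; exact: holo_differentiable (@euler_holo _ _ M a k) Xx. Qed.

(* The components of the Euler field have derivative 1 along the unit field,
   so that the points where they avoid prescribed values are dense. *)
Lemma generic_vanishing U f i (l : C) : open U -> U `<=` X ->
  (forall x, U x -> {for x, continuous f}) ->
  (forall x, U x -> (forall k, E x k != 0) -> E x i != l -> f x = 0) ->
  forall x, U x -> f x = 0.
Proof.
move=> oU UX cf f0 x Ux; apply: contrapT => /eqP fx.
(* [Some k] encodes the condition [E^k != 0] and [None] the condition [E^i != l]; a common solution
   is sought in the open set where [f] is nonzero. *)
pose F (t : option 'I_n.+1) (y : Cn) : C := if t is Some k then E y k else E y i - l.
pose v : Cn := \sum_j delta_mx 0 j.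
have Dv y k : X y -> 'D_v (fun y => E y k) y = 1.
  move=> Xy; rewrite derive_ones; last exact: euler_differentiable.
  rewrite (sum_one (i := k)); first by rewrite euler_derive// eqxx.
  by move=> j jk; rewrite euler_derive// (negbTE jk).
have [||y [Uy fy] Fy] := @common_nonzero _ _ _ (enum {: option 'I_n.+1}) F
    (U `&` [set y | f y != 0]) v (open_nonzero oU cf).
- by exists x.
- move=> t y _ [/UX Xy _]; case: t => [k|] /=.
    by split; [exact: euler_differentiable|exact: Dv].
  have dE := @euler_differentiable y i Xy.
  have dl := differentiable_cst (V := Cn) l y.
  split; first exact: differentiableB dE dl.
  have := deriveB (diff_derivable (v := v) dE) (diff_derivable (v := v) dl).
  by rewrite derive_cst subr0 Dv.
move/eqP: fy; apply; apply: f0 => // [k|].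
  by have := Fy (Some k); apply; rewrite mem_enum.
by rewrite -subr_eq0; have := Fy None; apply; rewrite mem_enum.
Qed.

End CanonicalGeometry.

(** * Commuting diagonal flows *)

Lemma mulmx_diagonal (F : pzRingType) n p (A : 'M[F]_n) (B : 'M[F]_(n, p)) i j :
  (forall k, k != i -> A i k = 0) -> (A *m B) i j = A i i * B i j.
Proof. by move=> dA; rewrite mxE (sum_one (i := i))// => k ki; rewrite dA// mul0r. Qed.

(** The quotient rule shared by the flow velocities and the [W^i]: [h] and [g] are [eta_ii] and
    [eta_jj], and [p] is [d_j eta_ii]. *)
Lemma velocity_identity (F : fieldType) (p h g s t : F) :
  (2 : F) != 0 -> h != 0 -> g != 0 ->
  (p / (2 * h) * s + p / (2 * g) * t) / h - s * p / h ^+ 2 =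
  p / (2 * h) * (t / g - s / h).
Proof. by move=> n2 h0 g0; field; rewrite ?n2 ?h0 ?g0. Qed.

Section CommutingDiagonalFlows.
Variables (R : realType) (n : nat).
Local Notation C := (Cplx R).
Local Notation Cn := 'rV[C]_n.+1.
Implicit Types (V W : Cn -> 'M[C]_n.+1) (U : set Cn) (u : Cn).

Lemma dirder_diag U V u (b : 'cV[C]_n.+1) i j : open U -> U u ->
  (forall y, U y -> forall i j, i != j -> V y i j = 0) ->
  dirder V u b i j = if i == j then \sum_k b k 0 * pd k (fun y => V y i i) u else 0.
Proof.
move=> oU Uu dV; rewrite mxE; case: eqVneq => [->//|ij].
rewrite big1// => k _; rewrite (pd_cst _ oU Uu (c := 0)) ?mulr0// => y Uy.
exact: dV.
Qed.

(** The terms in [b'] agree because diagonal matrices commute. In row [i], the difference of the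
    terms in [b k] and [b i] is governed for [k != i] by [A i k (V_kk - V_ii) (W_kk - W_ii)], which
    is symmetric in [V] and [W]. *)
Lemma commute_diagonal U V W u (A : 'I_n.+1 -> 'I_n.+1 -> C) : open U -> U u ->
  (forall y, U y -> forall i j, i != j -> V y i j = 0) ->
  (forall y, U y -> forall i j, i != j -> W y i j = 0) ->
  (forall i j, i != j ->
    pd j (fun y => V y i i) u = A i j * (V u j j - V u i i)) ->
  (forall i j, i != j ->
    pd j (fun y => W y i i) u = A i j * (W u j j - W u i i)) ->
  commute_at V W u.
Proof.
move=> oU Uu dV dW EV EW b b'; apply/matrixP => i z.
have mV (c : 'cV[C]_n.+1) k : (V u *m c) k 0 = V u k k * c k 0.
  by apply: mulmx_diagonal => l lk; apply: dV; rewrite // eq_sym.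
have mW (c : 'cV[C]_n.+1) k : (W u *m c) k 0 = W u k k * c k 0.
  by apply: mulmx_diagonal => l lk; apply: dW; rewrite // eq_sym.
have [g gE] : exists g, forall (T : Cn -> 'M[C]_n.+1) k,
    g T k = pd k (fun y => T y i i) u.
  by exists (fun T k => pd k (fun y => T y i i) u).
have D (T : Cn -> 'M[C]_n.+1) (c d : 'cV[C]_n.+1) :
    (forall y, U y -> forall i j, i != j -> T y i j = 0) ->
    (dirder T u c *m d) i 0 = (\sum_k c k 0 * g T k) * d i 0.
  move=> dT; rewrite mulmx_diagonal => [|k ki]; rewrite (dirder_diag c i _ oU Uu dT).
    by rewrite eqxx; congr (_ * _); apply: eq_bigr => k _; rewrite gE.
  by rewrite eq_sym (negbTE ki).
have key : \sum_k (V u *m b) k 0 * g W k + W u i i * \sum_k b k 0 * g V k =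
    \sum_k (W u *m b) k 0 * g V k + V u i i * \sum_k b k 0 * g W k.
  rewrite !mulr_sumr -!sumD; apply: eq_bigr => k _; rewrite mV mW.
  have [->|ki] := eqVneq k i.
    by rewrite addrC; congr (_ + _); rewrite mulrA.
  rewrite !gE EV 1?eq_sym// EW 1?eq_sym//; ring.
have addE (B B' : 'cV[C]_n.+1) : (B + B') i 0 = B i 0 + B' i 0 by rewrite mxE.
rewrite (ord1 z) addE (D W (V u *m b) b dW) (mW (_ + _) i) addE (D V b b dV) (mV b' i).
rewrite addE (D V (W u *m b) b dV) (mV (_ + _) i) addE (D W b b dW) (mW b' i).
have alg (p q r s x v' w' y : C) : p + w' * q = r + v' * s ->
    p * x + w' * (q * x + v' * y) = r * x + v' * (s * x + w' * y).
  by move=> H; rewrite !mulrDr !addrA !mulrA -!mulrDl H; congr (_ + _); ring.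
exact: alg key.
Qed.

End CommutingDiagonalFlows.

(** * The Gauss-Manin system and velocities in canonical coordinates *)

Section GaussManin.
Variables (R : realType) (n : nat) (M : frobenius_manifold R n) (a : chart M).
Hypothesis ha : canonical_chart a.
Local Notation C := (Cplx R).
Local Notation Cn := 'rV[C]_n.+1.
Local Notation X := (chart_img a).
Local Notation eta := (fm_eta a).
Local Notation E := (fm_euler a).
Implicit Types (x : Cn) (f : Cn -> C) (i j k : 'I_n.+1) (U : set Cn).

Let oX : open X := @img_open _ _ M a.
Let eta_diag x (Xx : X x) i j (ij : i != j) : eta x i j = 0 :=
  eta_canonical_diag ha Xx ij.
Let etaU x (Xx : X x) : eta x \in unitmx := eta_unit Xx.
Let eta0 x (Xx : X x) i : eta x i i != 0 := eta_canonical_neq0 ha i Xx.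

Lemma gup_canonical x i j : X x ->
  gup a x i j = if i == j then E x i / eta x i i else 0.
Proof.
move=> Xx; rewrite mxE (sum_one (i := j)).
  rewrite (sum_one (i := j)) => [|k kj]; last by rewrite ha.1// (negbTE kj) mulr0.
  rewrite ha.1// eqxx mulr1 -/(etaup a x) etaup_canonical//.
  by case: eqVneq => [->|_]; rewrite ?mulr0.
move=> k kj; rewrite big1 ?mulr0// => m _.
by rewrite ha.1// (negbTE kj) andbF mulr0.
Qed.

(** The complement of the discriminant in the chart, because [g] is diagonal with entries
    [E^i / eta_ii]. *)
Let nondeg : set Cn := X `&` [set x | forall k, E x k != 0].

Lemma open_nondeg : open nondeg.
Proof.
rewrite openE => x [Xx Ex]; apply: filterI; first by move: oX; rewrite openE; exact.
apply: (@filter_forall _ _ (fun k y => E y k != 0) _ (nbhs_filter x)) => k.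
have cE := differentiable_continuous (euler_differentiable k Xx).
exact: (cvgr_neq0 (E x k) cE (Ex k)).
Qed.

Lemma gup_unit x : nondeg x -> gup a x \in unitmx.
Proof.
move=> [Xx Ex]; have -> : gup a x = diag_mx (\row_i (E x i / eta x i i)).
  apply/matrixP => i j; rewrite gup_canonical// !mxE.
  by case: eqVneq; rewrite ?mulr1n ?mulr0n.
rewrite unitmxE det_diag unitfE; apply/prodf_neq0 => i _; rewrite mxE.
exact: mulf_neq0 (Ex i) (invr_neq0 (eta0 Xx i)).
Qed.

Lemma glow_canonical x i j : nondeg x ->
  glow a x i j = if i == j then eta x i i / E x i else 0.
Proof.
move=> nx; have [Xx Ex] := nx.
have [|_ ->] := invmx_diagonal (gup_unit nx) _ i j.
  by move=> k l kl; rewrite gup_canonical// (negbTE kl).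
by case: eqVneq => // _; rewrite gup_canonical// eqxx invf_div.
Qed.

Let glow_diag x (nx : nondeg x) i j (ij : i != j) : glow a x i j = 0.
Proof. by rewrite glow_canonical// (negbTE ij). Qed.

Let glow_unit x (nx : nondeg x) : glow a x \in unitmx.
Proof. by rewrite unitmx_inv; exact: gup_unit. Qed.

Lemma eta_derivable x i v : X x -> derivable (fun y => eta y i i) x v.
Proof.
by move=> Xx; apply: diff_derivable; exact: holo_differentiable (@eta_holo _ _ M a i i) Xx.
Qed.

(** The covariant entry is [eta_ii / E^i], and [E^i] has zero derivative along [j != i], so the
    logarithmic derivative is that of [eta_ii]. *)
Lemma lame_glow x i j : nondeg x -> i != j -> lame (glow a) x i j = lame eta x i j.
Proof.
move=> nx ij; have [Xx Ex] := nx; rewrite /lame.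
rewrite (eq_pd j open_nondeg nx (g := fun y => eta y i i / E y i)); last first.
  by move=> y ny; rewrite glow_canonical// eqxx.
have dE := diff_derivable (v := delta_mx 0 j) (euler_differentiable i Xx).
rewrite (pd_div (@eta_derivable x i _ Xx) dE (Ex i)) euler_derive//.
rewrite glow_canonical// eqxx [j == i]eq_sym (negbTE ij) mulr0 mul0r subr0.
have alg (p e h : C) : e != 0 -> p / e / (2 * (h / e)) = p / (2 * h).
  by move=> e0; rewrite [2 * _]mulrA invf_div mulrA divfK.
exact: alg.
Qed.

Lemma offdiag_hess_glow f x i j : nondeg x -> i != j ->
  hess (glow a) f x i j = offdiag_hess eta f x i j.
Proof.
move=> nx ij; rewrite (hess_offdiag open_nondeg glow_diag glow_unit _ nx ij).
by rewrite /offdiag_hess !lame_glow// eq_sym.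
Qed.

Lemma gup_hess f x i j : nondeg x -> i != j ->
  (gup a x *m hess (glow a) f x) i j = E x i / eta x i i * offdiag_hess eta f x i j.
Proof.
move=> nx ij; have [Xx _] := nx; rewrite mulmx_diagonal => [|k ki].
  by rewrite offdiag_hess_glow// gup_canonical// eqxx.
by rewrite gup_canonical// eq_sym (negbTE ki).
Qed.

Lemma ham_flow_canonical f x i j : X x ->
  ham_flow a f x i j = hess eta f x i j / eta x i i.
Proof.
move=> Xx; rewrite mulmx_diagonal => [|k ki].
  by rewrite etaup_canonical// eqxx mulrC.
by rewrite etaup_canonical// eq_sym (negbTE ki).
Qed.

Lemma etaup_hess f x i j : X x -> i != j ->
  (etaup a x *m hess eta f x) i j = offdiag_hess eta f x i j / eta x i i.
Proof.
move=> Xx ij; rewrite -(hess_offdiag oX eta_diag etaU f Xx ij).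
exact: ham_flow_canonical.
Qed.

Lemma offdiag_hess_continuous U f x i j : open U -> U `<=` X -> holo_on U f -> U x ->
  {for x, continuous (fun y => offdiag_hess eta f y i j)}.
Proof.
move=> oU UX hf Ux; have Xx := UX _ Ux.
have hd k : holo_on U (pd k f) by exact: holo_derive.
have c k : {for x, continuous (pd k f)}.
  exact: differentiable_continuous (holo_differentiable (hd k) Ux).
have cc : {for x, continuous (pd i (pd j f))}.
  exact: differentiable_continuous (holo_differentiable (holo_derive _ (hd j)) Ux).
have cl p q : {for x, continuous (fun y => lame eta y p q)}.
  have hp := @eta_holo _ _ M a p p.
  have c1 := differentiable_continuous
    (holo_differentiable (holo_derive (delta_mx 0 q) hp) Xx).
  have c2 := differentiable_continuous (holo_differentiable hp Xx).
  have ft := nbhs_filter x.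
  have n0 : 2 * eta x p p != 0 by exact: mulf_neq0 (@two_neq0 R) (eta0 Xx p).
  have c0 : (2 : C) @[_ --> x] --> (2 : C) by exact: cvg_cst.
  have c3 := @cvgM C _ _ ft _ _ _ _ c0 c2.
  exact: (@cvgM C _ _ ft _ _ _ _ c1 (@cvgV C _ _ ft _ _ n0 c3)).
have ft := nbhs_filter x.
have m1 := @cvgM C _ _ ft _ _ _ _ (cl i j) (c i).
have m2 := @cvgM C _ _ ft _ _ _ _ (cl j i) (c j).
exact: (@cvgB C C _ _ ft _ _ _ _ (@cvgB C C _ _ ft _ _ _ _ cc m1) m2).
Qed.

(** The [(i, j)] entry of the system says that [E^i - l] times [offdiag_hess] vanishes. Division is
    possible at generic points, and [generic_vanishing] extends the result by continuity. *)
Lemma gauss_manin_offdiag U f (l : C) i j : open U -> U `<=` X -> holo_on U f ->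
  (forall x, U x -> gauss_manin a l f x) -> i != j ->
  forall x, U x -> offdiag_hess eta f x i j = 0.
Proof.
move=> oU UX hf gm ij.
apply: (generic_vanishing ha (i := i) (l := l) oU UX) => x Ux.
  exact: offdiag_hess_continuous oU UX hf Ux.
move=> Ex El; have Xx := UX _ Ux; have nx : nondeg x by [].
have := congr1 (fun B : 'M[C]_n.+1 => B i j) (gm x Ux (gup_unit nx)).
rewrite /= gup_hess// [RHS]mxE etaup_hess//.
have alg (e h t : C) : h != 0 -> e != l -> e / h * t = l * (t / h) -> t = 0.
  move=> h0 el H; have : (e - l) * t = 0.
    by apply: (mulIf (invr_neq0 h0)); rewrite mul0r mulrBl mulrBl mulrAC H mulrA subrr.
  by move=> /eqP; rewrite mulf_eq0 subr_eq0 (negbTE el) => /eqP.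
exact: alg (eta0 Xx i) El.
Qed.

(** Induction on the order: the leading coefficient has zero Hessian for [eta], and off the
    discriminant the recursion makes the expression for [c m.+1] equal to [E^i] times the one for
    [c m]. *)
Lemma gauss_manin_series_offdiag U (c : nat -> Cn -> C) i j (m : nat) :
  open U -> U `<=` X -> (forall m, holo_on U (c m)) ->
  (forall x, U x -> gauss_manin_series a c x) -> i != j ->
  forall x, U x -> offdiag_hess eta (c m) x i j = 0.
Proof.
move=> oU UX hc gm ij; have divI (t h : C) : h != 0 -> t / h = 0 -> t = 0.
  by move=> h0 /eqP; rewrite mulf_eq0 invr_eq0 (negbTE h0) orbF => /eqP.
elim: m => [|m IH].
  move=> x Ux; have Xx := UX _ Ux; have [H _] := gm x Ux.
  have := congr1 (fun B : 'M[C]_n.+1 => B i j) H.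
  by rewrite /= etaup_hess// [RHS]mxE; exact: divI (eta0 Xx i).
(* The excluded value 0 of [E^i] repeats the nondegeneracy of [g]. *)
apply: (generic_vanishing ha (i := i) (l := 0) oU UX) => x Ux.
  exact: offdiag_hess_continuous oU UX (hc _) Ux.
move=> Ex _; have Xx := UX _ Ux; have nx : nondeg x by [].
have [_ H] := gm x Ux.
have Hij : (gup a x *m hess (glow a) (c m) x) i j =
    (etaup a x *m hess eta (c m.+1) x) i j by rewrite (H (gup_unit nx) m).
have alg (p q e z t h : C) : p = e * z -> q = t / h -> z = 0 -> p = q -> h != 0 -> t = 0.
  by move=> -> -> ->; rewrite mulr0 => /esym th h0; exact: divI h0 th.
exact: alg (gup_hess (c m) nx ij) (etaup_hess (c m.+1) Xx ij) (IH x Ux) Hij (eta0 Xx i).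
Qed.

Lemma ham_flow_offdiag f x i j : X x -> i != j -> offdiag_hess eta f x i j = 0 ->
  ham_flow a f x i j = 0.
Proof.
move=> Xx ij off; have alg (t h r s : C) : t = r / h -> r = s -> s = 0 -> t = 0.
  by move=> -> -> ->; rewrite mul0r.
exact: alg (ham_flow_canonical f i j Xx) (hess_offdiag oX eta_diag etaU f Xx ij) off.
Qed.

(** In the Codazzi equation for [d_j H_ii - d_i H_ji], with [H] the Hessian, the off-diagonal
    entries vanish; this leaves [d_j H_ii] in terms of [H_ii] and [H_jj]. The velocity is
    [H_ii / eta_ii], and the quotient rule concludes. *)
Lemma flow_velocities U f x i j : open U -> U `<=` X -> holo_on U f ->
  (forall y, U y -> forall p q, p != q -> offdiag_hess eta f y p q = 0) ->
  U x -> i != j ->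
  pd j (fun y => ham_flow a f y i i) x =
  lame eta x i j * (ham_flow a f x j j - ham_flow a f x i i).
Proof.
move=> oU UX hf off Ux ij; have Xx := UX _ Ux; have ji : j != i by rewrite eq_sym.
have hess0 y p q : U y -> p != q -> hess eta f y p q = 0.
  by move=> Uy pq; rewrite (hess_offdiag oX eta_diag etaU f (UX _ Uy) pq) off.
have dG k p q v : derivable (fun y => christoffel eta y k p q) x v.
  by apply: (derivable_christoffel oX eta_diag etaU) => //; exact: eta_holo.
have cod : pd j (fun y => hess eta f y i i) x =
    lame eta x i j * hess eta f x i i
    - - pd j (fun y => eta y i i) x / (2 * eta x j j) * hess eta f x j j.
  have alg (p q g1 g2 g3 g4 r s t w l m : C) : p - q = (g1 * r - g2 * s) + (g3 * t - g4 * w) ->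
      q = 0 -> s = 0 -> t = 0 -> g1 = l -> g4 = m -> p = l * r - m * w.
    by move=> H q0 s0 t0 <- <-; move: H; rewrite q0 s0 t0 !mulr0 !subr0 sub0r.
  have H := codazzi oU Ux dG (eta_flat Xx) i i j hf.
  rewrite (sum_two ij) in H; last first.
    move=> k ki kj; have ik : i != k by rewrite eq_sym.
    have jk : j != k by rewrite eq_sym.
    have alg0 (g g' r s : C) : r = 0 -> s = 0 -> g * r - g' * s = 0.
      by move=> -> ->; rewrite !mulr0 subrr.
    exact: alg0 (hess0 x i k Ux ik) (hess0 x j k Ux jk).
  have p0 : pd i (fun y => hess eta f y j i) x = 0.
    by apply: (pd_cst i oU Ux) => y Uy; exact: hess0.
  exact: alg H p0 (hess0 x j i Ux ji) (hess0 x i j Ux ij)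
    (christoffel_iji oX eta_diag etaU Xx ij) (christoffel_jii oX eta_diag etaU Xx ij).
rewrite (eq_pd j oX Xx (g := fun y => hess eta f y i i / eta y i i)); last first.
  by move=> y Xy; rewrite ham_flow_canonical.
have dh := @derivable_hess _ _ _ _ _ Ux dG f i i (delta_mx 0 j) hf.
rewrite (pd_div dh (@eta_derivable x i _ Xx) (eta0 Xx i)) cod.
rewrite (ham_flow_canonical f i i Xx) (ham_flow_canonical f j j Xx).
have alg (p h g s t : C) : h != 0 -> g != 0 ->
    (p / (2 * h) * s - - p / (2 * g) * t) / h - s * p / h ^+ 2 =
    p / (2 * h) * (t / g - s / h).
  by move=> h0 g0; rewrite !mulNr opprK; exact: velocity_identity (@two_neq0 R) h0 g0.
exact: alg (eta0 Xx i) (eta0 Xx j).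
Qed.

(** The vanishing of [offdiag_hess] expresses [d_j d_i f] through [d_i f] and [d_j f]; the Egorov
    property turns [d_i eta_jj] into [d_j eta_ii], so that both coefficients have the numerator
    required by [velocity_identity]. *)
Lemma symmetry_velocities U f x i j : open U -> U `<=` X -> holo_on U f ->
  (forall y, U y -> forall p q, p != q -> offdiag_hess eta f y p q = 0) ->
  U x -> i != j ->
  pd j (fun y => pd i f y / eta y i i) x =
  lame eta x i j * (pd j f x / eta x j j - pd i f x / eta x i i).
Proof.
move=> oU UX hf off Ux ij; have Xx := UX _ Ux; have ji : j != i by rewrite eq_sym.
have df : derivable (pd i f) x (delta_mx 0 j).
  by apply: diff_derivable; exact: holo_differentiable (holo_derive _ hf) Ux.
rewrite (pd_div df (@eta_derivable x i _ Xx) (eta0 Xx i)).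
(* Taken at [(j, i)], where the second derivative appears in the order produced by the quotient
   rule. *)
have := off x Ux j i ji; rewrite /offdiag_hess /lame (egorov ha j i Xx).
have alg (z p q s t : C) : z - p * t - q * s = 0 -> z = q * s + p * t.
  by move=> /eqP; rewrite !subr_eq0 subr_eq addrC => /eqP.
move=> /alg ->; exact: velocity_identity (@two_neq0 R) (eta0 Xx i) (eta0 Xx j).
Qed.

End GaussManin.

(** * The functions [W^i] as symmetries of the hierarchy *)

Lemma inverse_branch_symmetry (R : realType) (n : nat) (M : frobenius_manifold R n)
    (a : chart M) (ha : canonical_chart a) (S : superpotential a)
    (D : set 'rV[Cplx R]_n.+1) (H : hierarchy a D) (oD : open D)
    (DX : D `<=` chart_img a) (B : set (Cplx R * 'rV[Cplx R]_n.+1))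
    (p : Cplx R * 'rV[Cplx R]_n.+1 -> Cplx R)
    (iB : inverse_branch (sp_dom S) (lam S) B p) (l : Cplx R) :
  is_symmetry H (D `&` [set u | B (l, u)]) (fun i => Wfun a i p l).
Proof.
have [oB hp Bp] := iB.
pose UB := [set u | B (l, u)]; pose f := fun y => p (l, y).
have oUB : open UB := @open_slice R n B l oB.
have UBX : UB `<=` chart_img a by move=> u /Bp[/sp_sub].
have hf : holo_on UB f := @holo_on_slice R n B p l hp.
have offp u (Uu : UB u) i j (ij : i != j) : offdiag_hess (fm_eta a) f u i j = 0.
  by apply: (gauss_manin_offdiag ha oUB UBX hf (l := l)) => // y; exact: sp_gm iB l y.
have velW u i j : UB u -> i != j -> pd j (Wfun a i p l) u =
    lame (fm_eta a) u i j * (Wfun a j p l u - Wfun a i p l u).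
  by move=> Uu ij; exact: (symmetry_velocities ha oUB UBX hf offp Uu ij).
(* The flow velocities solve the system found for the [W^i] in [velW], with the same coefficients
   [lame]; commutation and the quotient form of the system rest on this coincidence. *)
have flowD V : hierarchy_flow H V ->
    (forall u, D u -> forall i j, i != j -> V u i j = 0) /\
    (forall u i j, D u -> i != j -> pd j (fun y => V y i i) u =
       lame (fm_eta a) u i j * (V u j j - V u i i)).
  move=> [al [m [k [mn ->]]]].
  have hd k' : holo_on D (dens H al m k') by exact: dens_holo.
  have offd u (Du : D u) i j (ij : i != j) :
      offdiag_hess (fm_eta a) (dens H al m k) u i j = 0.
    have gmd y : D y -> gauss_manin_series a (dens H al m) y by exact: dens_gm.
    have Z := @gauss_manin_series_offdiag R n M a ha D (dens H al m) i j k oD DX hd gmd ij u Du.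
    exact: Z.
  split; last by move=> u i j Du ij; exact: (flow_velocities ha oD DX (hd k) offd Du ij).
  by move=> u Du i j ij; exact: (ham_flow_offdiag ha (DX _ Du) ij (offd u Du i j ij)).
split=> [V u hV [Du Uu] | V u hV [Du Uu] injV i j ij | u [_ Uu] i j ij].
- have [diagV velV] := flowD V hV.
  apply: (@commute_diagonal R n D V _ u (lame (fm_eta a) u)) => //.
  + by move=> y _ i j ij; rewrite !mxE (negbTE ij).
  + by move=> i j; exact: velV.
  + move=> i j ij; rewrite !mxE !eqxx !mulr1n.
    rewrite (_ : (fun y => _) = Wfun a i p l); first exact: velW.
    by apply: boolp.funext => y; rewrite !mxE eqxx.
- have [_ velV] := flowD V hV.
  (* Dividing the equation for the flow by the difference of two velocities, nonzero by injectivity,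
     recovers [lame]. *)
  rewrite (velV u i j Du ij) (velW u i j Uu ij) mulfK//.
  by rewrite subr_eq0; apply: contra ij => /eqP /injV ->.
- exact: velW.
Qed.

Theorem theorem3 (R : realType) (n : nat) (M : frobenius_manifold R n)
    (hM : semisimple M) (hd : fm_charge M < 1)
    (a : chart M) (ha : canonical_chart a) (S : superpotential a) :
  (forall u : 'rV[Cplx R]_n.+1, chart_img a u ->
   forall Gam : 'I_n.+1 -> contour R,
   (forall k, small_contour (sp_dom S) (lam S) u (crit S k u) (Gam k)) ->
   forall P : 'I_n.+1 -> nat -> R -> Cplx R * 'rV[Cplx R]_n.+1 -> Cplx R,
   branches_on S u Gam P ->
   forall i j : 'I_n.+1,
     fm_eta a u i j =
       - (twopii R)^-1 * int_over_C S u Gam P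
                           (fun p l => dpinv i p l u * dpinv j p l u)
     /\
     etaup a u i j =
       - (twopii R)^-1 * int_over_C S u Gam P
                           (fun p l => Wfun a i p l u * Wfun a j p l u))
  /\
  (forall (D : set 'rV[Cplx R]_n.+1) (H : hierarchy a D),
     open D -> D `<=` chart_img a ->
   forall (B : set (Cplx R * 'rV[Cplx R]_n.+1))
          (p : Cplx R * 'rV[Cplx R]_n.+1 -> Cplx R),
     inverse_branch (sp_dom S) (lam S) B p ->
   forall l : Cplx R,
     is_symmetry H (D `&` [set u | B (l, u)]) (fun i => Wfun a i p l)).
Proof.
split=> [u ua Gam small P branches i j | D H oD DX B p iB l].
  exact: quadratic_expansions.
exact: (@inverse_branch_symmetry R n M a ha S D H oD DX B p iB l).
Qed.
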